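(* Let $(Z,X)$ be a pair of real random variables with a continuous joint distribution such that $X$ is stochastically increasing positive dependent (SIPD) in $Z$. Let $p_{\mathrm{success}}(n,m,\alpha)$ be its success probability, with $n\in\mathbb{N}$, $m\in\{1,\dots,n\}$, $\alpha\in(0,1]$. Then: (a) $p_{\mathrm{success}}(n,n,\alpha)=1-(1-\alpha)^n$. (b) $p_{\mathrm{success}}(n,m,1)=1$. (c) $\lim_{\alpha\to0^+}p_{\mathrm{success}}(n,m,\alpha)=0$. (d) If $Z$ and $X$ are comonotonic (i.e. $F_Z(Z)=F_X(X)$ for every realisation of $(Z,X)$), then $p_{\mathrm{success}}(n,m,\alpha)=1-(1-\alpha)^n$. (e) If $Z$ and $X$ are independent, then $p_{\mathrm{success}}(n,m,\alpha)=1-(1-\alpha)^m$. (f) For fixed $\alpha$, when $m\to\infty$ and $n\to\infty$ in any way such that $m\le n$, $\lim_{m,n\to\infty}p_{\mathrm{success}}(n,m,\alpha)=1$. (g) For fixed $\alpha$ and fixed finite $m$, $\lim_{n\to\infty}p_{\mathrm{success}}(n,m,\alpha)=1-\bigl(1-\mathcal{C}_{X|Z}(\alpha\mid0)\bigr)^m$.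
   Context: Setting. $(Z,X)$ has continuous joint CDF with marginal CDFs $F_Z,F_X$. Let $(Z_1,X_1),\dots,(Z_n,X_n)$ be i.i.d. copies of $(Z,X)$. Order the $Z$-values as $Z_{1:n}\le\dots\le Z_{n:n}$ (ties have probability zero), and let $X_{\langle i\rangle}$ be the $X$-value attached to $Z_{i:n}$, i.e. $X_{\langle i\rangle}=X_k$ when $Z_{i:n}=Z_k$. Success probability. For $1\le m\le n$ and $\alpha\in(0,1]$, $$p_{\mathrm{success}}(n,m,\alpha):=\Pr\Bigl(\min_{1\le i\le m}X_{\langle i\rangle}\le x_\alpha^*\Bigr),$$ where $x_\alpha^*$ is such that $\Pr(X\le x_\alpha^* )=\alpha$ (with $x_1^*=+\infty$ allowed). SIPD: $X$ is SIPD in $Z$ if $\Pr(X>x\mid Z=z)\le\Pr(X>x\mid Z=z')$ for all real $x$ and all $z\le z'$ in the support of $Z$ (for a suitable version of the conditional distribution). Conditional copula: $\mathcal{C}_{X|Z}(x\mid z):=\Pr(F_X(X)\le x\mid F_Z(Z)=z)$ for $z\in(0,1)$, taken in the version that is non-increasing in $z$ (available under SIPD). The boundary conditional CDF is $\mathcal{C}_{X|Z}(\alpha\mid0):=\lim_{z\to0^+}\mathcal{C}_{X|Z}(\alpha\mid z)$. *)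

(* Defs.v *)
From HB Require Import structures.
From mathcomp Require Import all_boot all_order all_algebra.
From mathcomp Require Import all_classical all_reals all_analysis.

Set Implicit Arguments.
Unset Strict Implicit.
Unset Printing Implicit Defensive.

Import Order.TTheory GRing.Theory Num.Theory.
Import numFieldNormedType.Exports.

Local Open Scope classical_set_scope.
Local Open Scope ring_scope.

Definition joint_cdf d (T : measurableType d) (R : realType)
    (P : probability T R) (Z X : {RV P >-> R}) (u : R * R) : R :=
  fine (P [set w | Z w <= u.1 /\ X w <= u.2]).

(* The random variable F_Y(Y). *)
Definition cdf_transform d (T : measurableType d) (R : realType)
    (P : probability T R) (Y : {RV P >-> R}) (w : T) : R :=
  fine (cdf Y (Y w)).

Definition independent_rv d (T : measurableType d) (R : realType)
    (P : probability T R) (Z X : {RV P >-> R}) : Prop :=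
  forall A B : set R, measurable A -> measurable B ->
    P (Z @^-1` A `&` X @^-1` B) = (P (Z @^-1` A) * P (X @^-1` B))%E.

Definition comonotonic d (T : measurableType d) (R : realType)
    (P : probability T R) (Z X : {RV P >-> R}) : Prop :=
  forall w, cdf Z (Z w) = cdf X (X w).

(* [K] is a version of the (regular) conditional distribution of [U] given
   [V]. *)
Definition is_cond_distribution d (T : measurableType d) (R : realType)
    (P : probability T R) (V U : T -> R) (K : R.-pker R ~> R) : Prop :=
  forall A B : set R, measurable A -> measurable B ->
    P (V @^-1` A `&` U @^-1` B) = (\int[P]_(w in V @^-1` A) K (V w) B)%E.

Definition rv_support d (T : measurableType d) (R : realType)
    (P : probability T R) (Z : {RV P >-> R}) : set R :=
  [set z | forall A : set R, open A -> A z -> (0 < P (Z @^-1` A))%E].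

(* [X] is stochastically increasing positive dependent in [Z]. *)
Definition sipd d (T : measurableType d) (R : realType)
    (P : probability T R) (Z X : {RV P >-> R}) : Prop :=
  exists2 K : R.-pker R ~> R, is_cond_distribution P Z X K &
    forall x z z' : R, rv_support Z z -> rv_support Z z' -> z <= z' ->
      (K z `]x, +oo[%classic <= K z' `]x, +oo[%classic)%E.

(* [K] is a version of the conditional distribution of F_X(X) given F_Z(Z)
   whose conditional CDFs are non-increasing in the conditioning value. *)
Definition is_cond_copula_kernel d (T : measurableType d) (R : realType)
    (P : probability T R) (Z X : {RV P >-> R}) (K : R.-pker R ~> R) : Prop :=
  is_cond_distribution P (cdf_transform Z) (cdf_transform X) K /\
  forall x z z' : R, 0 < z -> z <= z' -> z' < 1 ->
    (K z' `]-oo, x]%classic <= K z `]-oo, x]%classic)%E.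

Definition cond_copula (R : realType) (K : R.-pker R ~> R) (x z : R) : R :=
  fine (K z `]-oo, x]%classic).

Definition cond_copula0 (R : realType) (K : R.-pker R ~> R) (x : R) : R :=
  lim (cond_copula K x z @[z --> 0^'+]).

Definition iid_copies d (T : measurableType d) (R : realType)
    (P : probability T R) (Z X : {RV P >-> R})
    d' (T' : measurableType d') (Q : probability T' R) (n : nat)
    (Zs Xs : 'I_n -> {RV Q >-> R}) : Prop :=
  (forall (i : 'I_n) (A : set (R * R)), measurable A ->
     Q [set w | A (Zs i w, Xs i w)] = P [set w | A (Z w, X w)]) /\
  (forall (J : {set 'I_n}) (A : 'I_n -> set (R * R)),
     (forall i, measurable (A i)) ->
     Q [set w | forall i, i \in J -> A i (Zs i w, Xs i w)] =
     (\prod_(i in J) Q [set w | A i (Zs i w, Xs i w)])%E).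

(* The index [k] with Z_{i:n}(w) = Z_k(w), the position [i] being counted from
   0; ties, a null event, are broken by the smaller index (stable sort). *)
Definition order_index (R : realType) d (T : measurableType d)
    (Q : probability T R) (n : nat) (Zs : 'I_n -> {RV Q >-> R})
    (i : 'I_n) (w : T) : 'I_n :=
  tnth (sort_tuple (fun j k : 'I_n => Zs j w <= Zs k w) (ord_tuple n)) i.

Definition concomitant (R : realType) d (T : measurableType d)
    (Q : probability T R) (n : nat) (Zs Xs : 'I_n -> {RV Q >-> R})
    (i : 'I_n) (w : T) : R :=
  Xs (order_index Zs i w) w.

Definition p_success (R : realType) d (T : measurableType d)
    (Q : probability T R) (n : nat) (Zs Xs : 'I_n -> {RV Q >-> R})
    (m : nat) (xstar : \bar R) : R :=
  fine (Q [set w |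
    (\big[Order.min/+oo]_(i < n | (i < m)%N) (concomitant Zs Xs i w)%:E
       <= xstar)%E]).

(* Main.v *)
Require Import Defs.
From HB Require Import structures.
From mathcomp Require Import all_boot all_order all_algebra.
From mathcomp Require Import all_classical all_reals all_analysis.
From mathcomp Require Import measurable_realfun lra.
Import Order.TTheory GRing.Theory Num.Theory.
Import numFieldNormedType.Exports.
Local Open Scope classical_set_scope.
Local Open Scope ring_scope.

Set Implicit Arguments.
Unset Strict Implicit.
Unset Printing Implicit Defensive.

(** Let S be the event that the first m concomitants avoid the success set, so
    that p_success = 1 - P(S). Since F_Z(Z) is uniform, cut [0,1] into N cells
    and decompose the sample space according to the set J of the m smallest
    Z-values, the index k of the next one and the cell r of Z_k. On such a box
    S only constrains the X_j with j in J, and the i.i.d. product rule compares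
    P(S and box) with P(box) as soon as the ratios
    P(F_Z(Z) < t, X fails) / P(F_Z(Z) < t) are bounded by a constant c. The
    boxes cover everything except grid ties, of probability at most n^2 / N, so
    N -> oo bounds P(S) by c^m. Independence makes the ratios equal to
    1 - alpha, SIPD bounds them above by 1 - alpha, and near 0 they tend to
    1 - C(alpha | 0); the event that the (m+1)-st smallest F_Z(Z) is not small
    has probability tending to 0. *)

(** Given that the (m+1)-st smallest Z equals z, the m smaller pairs behave like i.i.d. copies of
    (Z, X) conditioned on Z < z; this is the source of c^m, with c bounding P(X fails | Z < z). The
    cells replace conditioning on a null event. Before the level r of the (m+1)-st value is frozen,
    the event that J holds the m smallest indices compares the Z_j with one another; afterwards it
    is a product of events on separate pairs. Intersecting the box with S then changes just the m
    factors over J. Pairs of indices sharing a cell are the price, and each costs at most 1/N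
    because a uniform variable puts at most 1/N in a cell. For m = n there is no next value; S then
    says that all n of the X_j fail, and independence gives its probability. The comonotonic case
    avoids boxes: up to a null event, failure of the pair with the smallest Z forces failure of all
    the others, which explains the exponent n in place of m. *)

Definition prob d (T : measurableType d) (R : realType)
  (P : probability T R) (A : set T) : R := fine (P A).

(** * Real-valued probabilities and finite unions *)

Section Prob.
Context d (T : measurableType d) (R : realType) (P : probability T R).
Local Notation pr := (prob P).
Implicit Types (A B : set T).

Lemma probE A : measurable A -> P A = (pr A)%:E.
Proof. by move=> mA; rewrite /prob fineK// fin_num_measure. Qed.

Lemma prob_ge0 A : 0 <= pr A.
Proof. exact/fine_ge0/measure_ge0. Qed.

Lemma le_prob A B : measurable A -> measurable B -> A `<=` B -> pr A <= pr B.
Proof.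
move=> mA mB AB; rewrite /prob fine_le ?fin_num_measure//.
by apply: le_measure => //; rewrite inE.
Qed.

Lemma prob_le1 A : measurable A -> pr A <= 1.
Proof. by move=> mA; rewrite -lee_fin -probE// probability_le1. Qed.

Lemma prob0 : pr set0 = 0.
Proof. by rewrite /prob measure0. Qed.

Lemma probT : pr setT = 1.
Proof. by rewrite /prob probability_setT. Qed.

Lemma probU A B : measurable A -> measurable B -> A `&` B = set0 ->
  pr (A `|` B) = pr A + pr B.
Proof.
move=> mA mB AB0; apply: EFin_inj.
by rewrite EFinD -!probE ?measureU//; exact: measurableU.
Qed.

Lemma probC A : measurable A -> pr (~` A) = 1 - pr A.
Proof.
move=> mA; rewrite -probT -(setUv A) probU ?setICr//; last exact: measurableC.
by rewrite addrC addKr.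
Qed.

Lemma probIC A B : measurable A -> measurable B ->
  pr (A `&` B) + pr (A `&` ~` B) = pr A.
Proof.
move=> mA mB; rewrite -probU ?setIUr_id//.
- by rewrite -setIUr setUv setIT.
- exact: measurableI.
- by apply: measurableI => //; exact: measurableC.
- by rewrite setIACA setICr setI0.
Qed.

Lemma probU_le A B : measurable A -> measurable B ->
  pr (A `|` B) <= pr A + pr B.
Proof.
move=> mA mB; have mBA : measurable (B `\` A) by exact: measurableD.
rewrite (_ : A `|` B = A `|` (B `\` A)) ?setUDr ?setDv ?setD0//.
rewrite -[X in pr X]setD0 -(setDv A) -setUDr probU//; last by rewrite setDE setICA setICr setI0.
by rewrite lerD2l le_prob//; exact: subIsetl.
Qed.

Lemma prob_bigcup_le (I : finType) (D : pred I) (F : I -> set T) :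
  (forall i, D i -> measurable (F i)) ->
  pr [set w | exists2 i, D i & F i w] <= \sum_(i | D i) pr (F i).
Proof.
move=> mF.
suff H (s : seq I) : all D s ->
    measurable [set w | exists2 i, i \in s & F i w] /\
    pr [set w | exists2 i, i \in s & F i w] <= \sum_(i <- s) pr (F i).
  have [|_] := H (enum D); first by apply/allP => i; rewrite mem_enum.
  rewrite big_enum; congr (prob _ _ <= _); apply/seteqP; split => w [i Di Fi];
    by exists i => //; rewrite ?mem_enum in Di *.
elim: s => [_|i s IHs /= /andP[Di Ds]].
  rewrite big_nil (_ : [set w | _] = set0) ?prob0//.
  by apply/seteqP; split => w // [].
have [m_s le_s] := IHs Ds.
have -> : [set w | exists2 j, j \in i :: s & F j w] =
    F i `|` [set w | exists2 j, j \in s & F j w].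
  apply/seteqP; split => w /=.
    by move=> [j]; rewrite inE => /orP[/eqP->|js]; [left | right; exists j].
  move=> [Fi|[j js Fj]]; first by exists i; rewrite ?mem_head.
  by exists j => //; rewrite inE js orbT.
split; first by apply: measurableU => //; exact: mF.
by rewrite big_cons (le_trans (probU_le (mF _ Di) m_s))// lerD2l.
Qed.

Lemma prob_bigcup (I : finType) (D : pred I) (F : I -> set T) :
  (forall i, D i -> measurable (F i)) ->
  (forall i j w, D i -> D j -> F i w -> F j w -> i = j) ->
  pr [set w | exists2 i, D i & F i w] = \sum_(i | D i) pr (F i).
Proof.
move=> mF dF.
suff H (s : seq I) : all D s -> uniq s ->
    measurable [set w | exists2 i, i \in s & F i w] /\
    pr [set w | exists2 i, i \in s & F i w] = \sum_(i <- s) pr (F i).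
  have [||_] := H (enum D); first by apply/allP => i; rewrite mem_enum.
    exact: enum_uniq.
  rewrite big_enum => <-; congr (prob _ _); apply/seteqP; split => w [i Di Fi];
    by exists i => //; rewrite ?mem_enum in Di *.
elim: s => [_ _|i s IHs /= /andP[Di Ds] /andP[iNs us]].
  rewrite big_nil (_ : [set w | _] = set0) ?prob0//.
  by apply/seteqP; split => w // [].
have [m_s le_s] := IHs Ds us.
have -> : [set w | exists2 j, j \in i :: s & F j w] =
    F i `|` [set w | exists2 j, j \in s & F j w].
  apply/seteqP; split => w /=.
    by move=> [j]; rewrite inE => /orP[/eqP->|js]; [left | right; exists j].
  move=> [Fi|[j js Fj]]; first by exists i; rewrite ?mem_head.
  by exists j => //; rewrite inE js orbT.
split; first by apply: measurableU => //; exact: mF.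
rewrite big_cons probU ?le_s//; first exact: mF.
apply/seteqP; split => w // [Fi [j js Fj]].
have Dj := allP Ds j js.
by move: iNs; rewrite (dF _ _ _ Di Dj Fi Fj) js.
Qed.

Lemma measurable_exists (I : finType) (D : pred I) (F : I -> set T) :
  (forall i, D i -> measurable (F i)) ->
  measurable [set w | exists2 i, D i & F i w].
Proof. by move=> mF; apply: fin_bigcup_measurable; first exact: finite_finset. Qed.

Lemma measurable_forall (I : finType) (D : pred I) (F : I -> set T) :
  (forall i, D i -> measurable (F i)) ->
  measurable [set w | forall i, D i -> F i w].
Proof. by move=> mF; apply: fin_bigcap_measurable; first exact: finite_finset. Qed.

End Prob.

(** * The sorting permutation of the Z-values *)

Lemma card_ord_lt n m : (m <= n)%N -> #|[set i : 'I_n | (i < m)%N]%SET| = m.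
Proof.
by move=> mn; rewrite -sum1dep_card -(big_ord_widen n (fun=> 1%N) mn) sum1_card card_ord.
Qed.

Section OrderIndex.
Context (R : realType) d (T : measurableType d) (Q : probability T R) (n : nat).
Variables (Zs : 'I_n -> {RV Q >-> R}).
Implicit Types (w : T) (i j : 'I_n) (J : {set 'I_n}).

Lemma order_index_inj w : injective ((order_index Zs)^~ w).
Proof. by apply/tuple_uniqP; rewrite sort_uniq enum_uniq. Qed.

Lemma order_index_le w i j : (i <= j)%N ->
  Zs (order_index Zs i w) w <= Zs (order_index Zs j w) w.
Proof.
move=> ij; rewrite /order_index !(tnth_nth i).
apply: (@sorted_leq_nth _ (fun j k => Zs j w <= Zs k w)) => //.
- by move=> a b c; exact: le_trans.
- by apply: sort_sorted => a b; exact: le_total.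
- by rewrite inE size_tuple.
- by rewrite inE size_tuple.
Qed.

Lemma order_index_surj w k : exists i, order_index Zs i w = k.
Proof.
have [g _ gK] := injF_bij (@order_index_inj w).
by exists (g k).
Qed.

(** If a position [i < m] held an index outside [J], every index of [J] would have a strictly
    smaller value and sit before [i], so that [#|J| <= i < m]. The resulting inclusion is an
    equality by cardinality. *)
Lemma order_index_first w J m : #|J| = m ->
  (forall j k, j \in J -> k \notin J -> Zs j w < Zs k w) ->
  [set order_index Zs i w | i in [set i : 'I_n | (i < m)%N]]%SET = J.
Proof.
move=> cJ sepJ.
have inJ i : (i < m)%N -> order_index Zs i w \in J.
  move=> im; apply/negPn/negP => iNJ.
  have : J \subset [set order_index Zs j w | j in [set j : 'I_n | (j < i)%N]]%SET.
    apply/fintype.subsetP => k kJ; have [j jk] := order_index_surj w k.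
    rewrite -jk imset_f// inE ltnNge; apply/negP => ij.
    by have := order_index_le w ij; rewrite leNgt jk sepJ.
  move/subset_leq_card; rewrite cJ card_imset; last exact: order_index_inj.
  by rewrite (card_ord_lt (ltnW (ltn_ord i))) leqNgt im.
apply/eqP; rewrite eqEcard; apply/andP; split.
  by apply/fintype.subsetP => k /imsetP[i]; rewrite inE => im ->; exact: inJ.
rewrite card_imset ?cJ; last exact: order_index_inj.
by rewrite card_ord_lt// -cJ -[X in (_ <= X)%N]card_ord max_card.
Qed.

(** The sort sees [w] only through the finite table of comparisons between the Z-values, so the
    event is a finite union, over tables, of finite intersections of comparison events. *)
Lemma measurable_order_index i k : measurable [set w | order_index Zs i w = k].
Proof.
pose pat w : {ffun 'I_n * 'I_n -> bool} :=
  [ffun u => Zs u.1 w <= Zs u.2 w].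
pose idx (M : {ffun 'I_n * 'I_n -> bool}) : 'I_n :=
  tnth (sort_tuple (fun a b => M (a, b)) (ord_tuple n)) i.
have idxE w : order_index Zs i w = idx (pat w).
  rewrite /idx /order_index; congr (tnth _ _).
  by congr sort_tuple; apply/funext => a; apply/funext => b; rewrite ffunE.
have -> : [set w | order_index Zs i w = k] =
    [set w | exists2 M, idx M == k & forall u, true -> M u = (Zs u.1 w <= Zs u.2 w)].
  apply/seteqP; split => w /=.
    by rewrite idxE => /eqP e; exists (pat w) => // u _; rewrite ffunE.
  move=> [M /eqP <- e]; rewrite idxE; congr idx.
  by apply/ffunP => u; rewrite ffunE e.
apply: measurable_exists => M _; apply: measurable_forall => u _.
have mle : measurable [set w | Zs u.1 w <= Zs u.2 w].
  rewrite -[X in measurable X]setTI; exact: measurable_fun_le.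
case: (M u).
  rewrite [X in measurable X](_ : _ = [set w | Zs u.1 w <= Zs u.2 w])//.
  by apply/seteqP; split => w /= <-.
rewrite [X in measurable X](_ : _ = ~` [set w | Zs u.1 w <= Zs u.2 w]); first exact: measurableC.
by apply/seteqP; split => w /=; [move=> <- | move/negP/negbTE].
Qed.

End OrderIndex.

(** * Events on the first concomitants *)

Lemma measurable_pair_rv d (T : measurableType d) (R : realType)
    (P : probability T R) (Z X : {RV P >-> R}) (A : set (R * R)) :
  measurable A -> measurable [set w | A (Z w, X w)].
Proof.
move=> mA; rewrite -[X in measurable X]setTI.
have mZX : measurable_fun setT (fun w => (Z w, X w)) by exact: measurable_fun_pair.
exact: mZX.
Qed.

Section FirstConcomitants.
Context (R : realType) d (T : measurableType d) (Q : probability T R) (n : nat).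
Variables (Zs Xs : 'I_n -> {RV Q >-> R}) (B : set R) (m : nat).

(** With [B] the failure set [x > xstar], this is the complement of the success event. *)
Definition first_in := [set w | forall i : 'I_n, (i < m)%N ->
  B (concomitant Zs Xs i w)].

Lemma measurable_first_in : measurable B -> measurable first_in.
Proof.
move=> mB; rewrite /first_in.
have -> : [set w | forall i : 'I_n, (i < m)%N -> B (concomitant Zs Xs i w)] =
    [set w | forall i : 'I_n, (i < m)%N ->
      [set w | exists2 k, true & [set w | order_index Zs i w = k] w /\ B (Xs k w)] w].
  apply/seteqP; split => w /= H i im.
    by exists (order_index Zs i w) => //; split => //; exact: H.
  by have [k _ [<- ]] := H i im.
apply: measurable_forall => i _; apply: measurable_exists => k _.
apply: measurableI; first exact: measurable_order_index.
by rewrite -[X in measurable X]setTI; exact: measurable_funP.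
Qed.

(** Once [J] is separated from the other indices the sort disappears: the first [m] concomitants are
    the X-values over [J] in some order. *)
Lemma first_inP (J : {set 'I_n}) w : #|J| = m ->
  (forall j k, j \in J -> k \notin J -> Zs j w < Zs k w) ->
  first_in w <-> forall j, j \in J -> B (Xs j w).
Proof.
move=> cJ sepJ; have JE := order_index_first cJ sepJ; split => [H j|H i im].
  rewrite -JE => /imsetP[i]; rewrite inE => im ->; exact: H.
by apply: H; rewrite -JE imset_f// inE.
Qed.

End FirstConcomitants.

(** * Box decomposition and bounds on the failure probability *)

Section Boxes.
Context (R : realType) d (T : measurableType d) (P : probability T R)
  (Z X : {RV P >-> R}) d' (T' : measurableType d') (Q : probability T' R)
  (n : nat) (Zs Xs : 'I_n -> {RV Q >-> R}).
Hypothesis iid : iid_copies Z X Zs Xs.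
Local Notation prP := (prob P).
Local Notation prQ := (prob Q).

Lemma prob_copy i (A : set (R * R)) : measurable A ->
  prQ [set w | A (Zs i w, Xs i w)] = prP [set w | A (Z w, X w)].
Proof. by move=> mA; rewrite /prob iid.1. Qed.

Lemma prob_copies (J : {set 'I_n}) (A : 'I_n -> set (R * R)) :
  (forall i, measurable (A i)) ->
  prQ [set w | forall i, i \in J -> A i (Zs i w, Xs i w)] =
  \prod_(i in J) prP [set w | A i (Z w, X w)].
Proof.
move=> mA; rewrite {1}/prob iid.2//.
rewrite (eq_bigr (fun i => (prP [set w | A i (Z w, X w)])%:E)) ?prodEFin// => i _.
by rewrite -(prob_copy i)// -probE//; exact: measurable_pair_rv.
Qed.

Lemma measurable_copies (J : {set 'I_n}) (A : 'I_n -> set (R * R)) :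
  (forall i, measurable (A i)) ->
  measurable [set w | forall i, i \in J -> A i (Zs i w, Xs i w)].
Proof.
by move=> mA; apply: measurable_forall => i _; exact: measurable_pair_rv.
Qed.

(** [f] stands for F_Z; the interval bound [f_unif] is the form in which uniformity of F_Z(Z)
    enters. *)
Variables (B : set R) (f : R -> R).
Hypothesis mB : measurable B.
Hypothesis f_nd : {homo f : x y / x <= y}.
Hypothesis f01 : forall z, 0 <= f z <= 1.
Hypothesis f_unif : forall a b, a <= b ->
  prP [set w | a <= f (Z w) < b] <= b - a.

Let mf : measurable_fun setT f.
Proof. by apply: nondecreasing_measurable. Qed.

Section Grid.
Variable (N : nat).
Hypothesis N_gt0 : (0 < N)%N.

(** The grid level of [z], for cells of width 1/N on the scale of [f]. Level [N] occurs exactly when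
    [f z = 1], which is why levels live in ['I_N.+1]. *)
Let q (z : R) : nat := Num.trunc (N%:R * f z).

Let Nf_ge0 z : 0 <= N%:R * f z.
Proof. by rewrite mulr_ge0//; have /andP[] := f01 z. Qed.

Let q_lt x y : (q x < q y)%N -> x < y.
Proof.
apply: contraTT; rewrite -leNgt -leqNgt => yx; apply: le_truncn.
by rewrite ler_wpM2l// f_nd.
Qed.

Let q_le z : (q z <= N)%N.
Proof.
rewrite -(natrK (R := R) N); apply: le_truncn.
by rewrite ler_piMr//; have /andP[] := f01 z.
Qed.

Let mq (S : nat -> bool) (C : set R) : measurable C ->
  measurable [set u : R * R | S (q u.1) /\ C u.2].
Proof.
move=> mC; apply: measurableI; last first.
  rewrite -[X in measurable X]setTI; exact: measurable_snd.
pose D := \bigcup_(r in [set r | S r]) ((fun z => (q z)%:R : R) @^-1` [set r%:R]).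
have mD : measurable D.
  apply: bigcup_measurable => r _; rewrite -[X in measurable X]setTI.
  apply: nondecreasing_measurable => // x y xy.
  by rewrite ler_nat; apply: le_truncn; rewrite ler_wpM2l// f_nd.
rewrite [X in measurable X](_ : _ = [set u | D u.1]).
  rewrite -[X in measurable X]setTI; exact: measurable_fst.
apply/seteqP; split => u /= => [Su|[r Sr /= /eqP]]; first by exists (q u.1).
by rewrite eqr_nat => /eqP ->.
Qed.

(* [box C (J, k, r)]: the indices in [J] carry grid levels below [r] and
   X-values in [C], index [k] has level exactly [r], the others lie above [r]. *)
Definition cell (J : {set 'I_n}) (k : 'I_n) (r : 'I_N.+1) (C : set R) (j : 'I_n) :
    set (R * R) :=
  [set u | (if j \in J then (q u.1 < r)%N else
            if j == k then q u.1 == r else (r < q u.1)%N) /\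
           (if j \in J then C else setT) u.2].

Definition box C (v : {set 'I_n} * 'I_n * 'I_N.+1) : set T' :=
  [set w | forall j, j \in [set: 'I_n]%SET ->
    cell v.1.1 v.1.2 v.2 C j (Zs j w, Xs j w)].

Let mcell J k r C : measurable C -> forall j, measurable (cell J k r C j).
Proof.
move=> mC j; pose S p := if j \in J then (p < r)%N else
            if j == k then p == r :> nat else (r < p)%N.
by apply: (mq S); case: ifP.
Qed.

Let mbox C v : measurable C -> measurable (box C v).
Proof. by move=> mC; apply: measurable_copies => j; exact: mcell. Qed.

Variable m : nat.
Let valid (v : {set 'I_n} * 'I_n * 'I_N.+1) :=
  (#|v.1.1| == m) && (v.1.2 \notin v.1.1).

Lemma box_sep C v w j k : valid v -> box C v w -> j \in v.1.1 -> k \notin v.1.1 ->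
  Zs j w < Zs k w.
Proof.
move=> /andP[_ kN] H jJ kJ; apply: q_lt.
have [] := H j (finset.in_setT j); rewrite jJ /= => qj _.
have [] := H k (finset.in_setT k); rewrite (negbTE kJ) /= => + _.
by case: ifP => [_ /eqP ->//|_]; exact: ltn_trans.
Qed.

(** Separation identifies [J] as the first [m] indices. Two different choices of [k] would each have
    a level strictly above the other, a contradiction; and [r] is the level of [k]. *)
Lemma box_inj C u v w : valid u -> valid v -> box C u w -> box C v w -> u = v.
Proof.
move=> vu vv Hu Hv.
have JJ : u.1.1 = v.1.1.
  case/andP: (vu) => /eqP cu _; case/andP: (vv) => /eqP cv _.
  rewrite -(@order_index_first R d' T' Q n Zs w _ m cu); last first.
    by move=> j k; exact: (box_sep vu Hu).
  by rewrite -(@order_index_first R d' T' Q n Zs w _ m cv)// => j k; exact: (box_sep vv Hv).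
have ku : u.1.2 \notin u.1.1 by case/andP: vu.
have kv : v.1.2 \notin v.1.1 by case/andP: vv.
have [] := Hu u.1.2 (finset.in_setT _); rewrite (negbTE ku) eqxx /= => /eqP qu _.
have [] := Hv v.1.2 (finset.in_setT _); rewrite (negbTE kv) eqxx /= => /eqP qv _.
have kk : u.1.2 = v.1.2.
  apply/eqP/negPn/negP => neq.
  have [] := Hu v.1.2 (finset.in_setT _); rewrite JJ (negbTE kv) eq_sym (negbTE neq) /= qv => ruv _.
  have [] := Hv u.1.2 (finset.in_setT _); rewrite -JJ (negbTE ku) (negbTE neq) /= qu => rvu _.
  by have := ltn_trans ruv rvu; rewrite ltnn.
have rr : u.2 = v.2 by apply: ord_inj; rewrite -qu -qv kk.
by move: u v JJ kk rr {vu vv Hu Hv ku kv qu qv} => [[? ?] ?] [[? ?] ?] /= -> -> ->.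
Qed.

(** On a box the first [m] indices are known, so intersecting with [first_in] gives again a
    coordinatewise event, to which the product rule applies. *)
Lemma box_first C v w : valid v -> box C v w <-> box setT v w /\ first_in Zs Xs C m w.
Proof.
move=> vv; have cJ : #|v.1.1| = m by case/andP: vv => /eqP.
split=> [Hw|[Hw Fw] j _].
  split=> [j _|]; first by have [? _] := Hw j (finset.in_setT j); split => //; case: ifP.
  apply/(first_inP Xs C cJ (fun j k => @box_sep C v w j k vv Hw)) => j jJ.
  by have [_] := Hw j (finset.in_setT j); rewrite jJ.
have [? _] := Hw j (finset.in_setT j); split => //; case: ifP => // jJ.
by move/(first_inP Xs C cJ (fun j k => @box_sep _ v w j k vv Hw)): Fw; exact.
Qed.

Definition tie : set T' :=
  [set w | exists2 ij : 'I_n * 'I_n, ij.1 != ij.2 & q (Zs ij.1 w) = q (Zs ij.2 w)].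

(** Without grid ties the levels increase strictly along the sorted indices, so [J] can be the first
    [m] of them, [k] the next (position [m], counted from 0) and [r] its level. *)
Lemma box_cover w (mn : (m < n)%N) : ~ tie w ->
  exists2 v, valid v && (v.2 == q (Zs (order_index Zs (Ordinal mn) w) w) :> nat)
    & box setT v w.
Proof.
move=> ntie; set k := order_index Zs (Ordinal mn) w.
have qinj a b : q (Zs a w) = q (Zs b w) -> a = b.
  by move=> e; apply/eqP/negPn/negP => ab; apply: ntie; exists (a, b).
pose J := [set order_index Zs i w | i in [set i : 'I_n | (i < m)%N]]%SET.
have qle (a b : 'I_n) : (a <= b)%N ->
    (q (Zs (order_index Zs a w) w) <= q (Zs (order_index Zs b w) w))%N.
  move=> ab; apply: le_truncn; rewrite ler_wpM2l// f_nd//.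
  exact: order_index_le.
have inJ i : (order_index Zs i w \in J) = (i < m)%N.
  apply/imsetP/idP => [[j]|im]; last by exists i; rewrite ?inE.
  by rewrite inE => jm /order_index_inj ->.
exists (J, k, Ordinal (q_le (Zs k w) : (_ < N.+1)%N)).
  rewrite /valid /= eqxx inJ /= ltnn andbT card_imset ?card_ord_lt ?eqxx//.
    exact: ltnW.
  exact: order_index_inj.
move=> j _; have [i <-] := order_index_surj Zs w j; split; last by case: ifP.
rewrite inJ /=; case: ltnP => im.
  rewrite ltn_neqAle qle ?andbT; last exact: ltnW.
  by apply/eqP => /qinj /order_index_inj e; move: im; rewrite e /= ltnn.
case: eqP => [->//|/eqP ne]; rewrite ltn_neqAle qle// andbT.
by apply/eqP => /qinj e; rewrite -e eqxx in ne.
Qed.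

Let qr_le (r : nat) : prP [set w | q (Z w) == r] <= N%:R^-1.
Proof.
have Np : 0 < N%:R :> R by rewrite ltr0n.
have -> : N%:R^-1 = r.+1%:R / N%:R - r%:R / N%:R :> R by rewrite -mulrBl -natrB// subSnn mul1r.
rewrite -[X in prP X](_ : [set w | r%:R / N%:R <= f (Z w) < r.+1%:R / N%:R] = _).
  by apply: f_unif; rewrite ler_pM2r ?invr_gt0// ler_nat.
apply/seteqP; split => w /=; rewrite truncn_eq//.
  by rewrite ler_pdivrMr// ltr_pdivlMr// mulrC.
by rewrite ler_pdivrMr// ltr_pdivlMr// [f _ * _]mulrC.
Qed.

Let mtie2 i j : measurable [set w | q (Zs i w) = q (Zs j w)].
Proof.
rewrite [X in measurable X](_ : _ = [set w | exists2 r : 'I_N.+1, true &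
    forall k, k \in [set i; j]%SET -> [set u | q u.1 == r /\ setT u.2] (Zs k w, Xs k w)]).
  apply: measurable_exists => r _.
  apply: (@measurable_copies [set i; j]%SET (fun=> [set u | q u.1 == r /\ setT u.2])) => _.
  exact: (mq (fun p => p == r :> nat)).
apply/seteqP; split => w /=.
  move=> e; exists (Ordinal (q_le (Zs j w) : (_ < N.+1)%N)) => // k.
  by rewrite !inE => /orP[] /eqP -> /=; rewrite ?e eqxx.
move=> [r _ H]; have [|/eqP -> _] := H i; first by rewrite !inE eqxx.
by have [|/eqP -> _] := H j; first by rewrite !inE eqxx orbT.
Qed.

Let mtie : measurable tie.
Proof. by apply: measurable_exists => ij _; exact: mtie2. Qed.

(** By independence the probability is the sum over levels of P(level r)^2. One factor is at most
    1/N, and the others sum to at most 1. *)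
Let prob_tie2 i j : i != j -> prQ [set w | q (Zs i w) = q (Zs j w)] <= N%:R^-1.
Proof.
move=> ij; pose F (r : 'I_N.+1) := [set w | forall k, k \in [set i; j]%SET ->
  [set u | q u.1 == r /\ setT u.2] (Zs k w, Xs k w)].
have mqr (r : 'I_N.+1) : measurable [set u : R * R | q u.1 == r /\ setT u.2].
  exact: (mq (fun p => p == r :> nat)).
have mF r : measurable (F r).
  by apply: (@measurable_copies [set i; j]%SET (fun=> [set u | q u.1 == r /\ setT u.2])).
have mqZ (r : 'I_N.+1) : measurable [set w | q (Z w) == r].
  rewrite [X in measurable X](_ : _ = [set w | [set u | q u.1 == r /\ setT u.2] (Z w, X w)]).
    exact: measurable_pair_rv.
  by apply/seteqP; split => w //= [].
apply: (@le_trans _ _ (\sum_(r < N.+1) prQ (F r))).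
  apply: (@le_trans _ _ (prQ [set w | exists2 r, true & F r w])); last first.
    by apply: prob_bigcup_le => r _.
  apply: le_prob => //; first exact: measurable_exists.
  move=> w /= e; exists (Ordinal (q_le (Zs j w) : (_ < N.+1)%N)) => // k.
  by rewrite !inE => /orP[] /eqP -> /=; rewrite ?e eqxx.
apply: (@le_trans _ _ (\sum_(r < N.+1) N%:R^-1 * prP [set w | q (Z w) == r])).
  apply: ler_sum => r _; rewrite /F (@prob_copies [set i; j]%SET (fun=> [set u | q u.1 == r /\ setT u.2]))//.
  rewrite prodr_const cards2 ij expr2.
  have -> : [set w | [set u | q u.1 == r /\ setT u.2] (Z w, X w)] = [set w | q (Z w) == r].
    by apply/seteqP; split => w //= [].
  by rewrite ler_wpM2r ?prob_ge0.
rewrite -mulr_sumr -[leRHS]mulr1 ler_wpM2l ?invr_ge0//.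
rewrite -prob_bigcup//; first by apply: prob_le1; exact: measurable_exists.
by move=> r s w _ _ /= /eqP -> /eqP e; exact: val_inj.
Qed.

Lemma prob_tie : prQ tie <= (n ^ 2)%:R / N%:R.
Proof.
apply: (@le_trans _ _ (\sum_(ij : 'I_n * 'I_n | ij.1 != ij.2)
    prQ [set w | q (Zs ij.1 w) = q (Zs ij.2 w)])).
  by apply: prob_bigcup_le => ij _; exact: mtie2.
apply: (@le_trans _ _ (\sum_(ij : 'I_n * 'I_n) N%:R^-1)).
  rewrite [leRHS](bigID (fun ij => ij.1 != ij.2)) /= -[leLHS]addr0.
  by apply: lerD; [apply: ler_sum => ij; exact: prob_tie2 | apply: sumr_ge0].
by rewrite sumr_const card_prod card_ord mulnn mulr_natl.
Qed.

Let prob_box C v : measurable C -> valid v ->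
  prQ (box C v) = \prod_j prP [set w | cell v.1.1 v.1.2 v.2 C j (Z w, X w)].
Proof.
move=> mC vv; rewrite /box prob_copies; last exact: mcell.
by apply: eq_bigl => j; rewrite inE.
Qed.

Let prod_if (J : {set 'I_n}) (c : R) : #|J| = m -> \prod_j (if j \in J then c else 1) = c ^+ m.
Proof. by move=> <-; rewrite -big_mkcond prodr_const. Qed.

Let below_cell (r : nat) : [set w | [set u | (q u.1 < r)%N /\ setT u.2] (Z w, X w)] =
   [set w | f (Z w) < r%:R / N%:R].
Proof.
have Np : 0 < N%:R :> R by rewrite ltr0n.
apply/seteqP; split => w /=; rewrite ltr_pdivlMr// mulrC truncn_lt_nat//.
by case.
Qed.

Let below_cellB (r : nat) : [set w | [set u | (q u.1 < r)%N /\ B u.2] (Z w, X w)] =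
   [set w | f (Z w) < r%:R / N%:R /\ B (X w)].
Proof.
have Np : 0 < N%:R :> R by rewrite ltr0n.
by apply/seteqP; split => w /=; rewrite ltr_pdivlMr// mulrC truncn_lt_nat//.
Qed.

(** Both sides are products over all indices which agree off [J]; each of the [m] factors over [J]
    contributes one ratio bounded by [c]. *)
Lemma prob_box_le c v : 0 <= c -> valid v ->
  prP [set w | f (Z w) < v.2%:R / N%:R /\ B (X w)] <=
    c * prP [set w | f (Z w) < v.2%:R / N%:R] ->
  prQ (box B v) <= c ^+ m * prQ (box setT v).
Proof.
move=> c0 vv; rewrite -below_cellB -below_cell => le_c; rewrite !prob_box//.
rewrite -(@prod_if v.1.1 c); last by case/andP: vv => /eqP.
rewrite -big_split /=; apply: ler_prod => j _; rewrite prob_ge0 /= /cell.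
by case: ifP => _ //; rewrite mul1r.
Qed.

Lemma prob_box_ge c v : 0 <= c -> valid v ->
  c * prP [set w | f (Z w) < v.2%:R / N%:R] <=
    prP [set w | f (Z w) < v.2%:R / N%:R /\ B (X w)] ->
  c ^+ m * prQ (box setT v) <= prQ (box B v).
Proof.
move=> c0 vv; rewrite -below_cellB -below_cell => le_c; rewrite !prob_box//.
rewrite -(@prod_if v.1.1 c); last by case/andP: vv => /eqP.
rewrite -big_split /=; apply: ler_prod => j _; rewrite /cell.
case: ifP => _ /=; first by rewrite mulr_ge0// prob_ge0.
by rewrite mul1r prob_ge0 lexx.
Qed.

(** Summing over the disjoint boxes gives [c ^+ m] times their total mass, which is at least 1 minus
    the mass of [tie]. *)
Lemma grid_lower c (mn : (m < n)%N) : 0 <= c ->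
  (forall t, c * prP [set w | f (Z w) < t] <= prP [set w | f (Z w) < t /\ B (X w)]) ->
  c ^+ m * (1 - (n ^ 2)%:R / N%:R) <= prQ (first_in Zs Xs B m).
Proof.
move=> c0 Hc.
have mU C : measurable C -> measurable [set w | exists2 v, valid v & box C v w].
  by move=> mC; apply: measurable_exists => v _; exact: mbox.
have : prQ [set w | exists2 v, valid v & box B v w] <= prQ (first_in Zs Xs B m).
  apply: le_prob; [exact: mU | exact: measurable_first_in |].
  by move=> w /= [v vv /(box_first _ _ vv)[]].
apply: le_trans; rewrite prob_bigcup; first last.
  by move=> u v w vu vv; exact: box_inj.
  by move=> v _; exact: mbox.
apply: (@le_trans _ _ (\sum_(v | valid v) c ^+ m * prQ (box setT v))); last first.
  by apply: ler_sum => v vv; exact: prob_box_ge.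
rewrite -mulr_sumr ler_wpM2l ?exprn_ge0// -prob_bigcup; first last.
  by move=> u v w vu vv; exact: box_inj.
  by move=> v _; exact: mbox.
rewrite lerBlDr; apply: le_trans (_ : prQ setT <= _); first by rewrite probT.
apply: le_trans (_ : _ <= prQ ([set w | exists2 v, valid v & box setT v w] `|` tie)) _.
  apply: le_prob => //; first by apply: measurableU => //; exact: mU.
  move=> w _; have [t|nt] := pselect (tie w); [by right | left].
  by have [v /andP[vv _] bv] := box_cover mn nt; exists v.
by apply: (le_trans (probU_le _ _ _)) => //; [exact: mU | rewrite lerD2l prob_tie].
Qed.

(** The ratio bound is available below [delta] only. A box with r/N at least [delta] has its
    (m+1)-st value there too, since r is the truncation of N times that value; such boxes go into
    [L]. Any measurable superset serves as [L], so a convenient union can be chosen later. *)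
Lemma grid_upper c delta (mn : (m < n)%N) : 0 <= c ->
  (forall t, t < delta -> prP [set w | f (Z w) < t /\ B (X w)] <= c * prP [set w | f (Z w) < t]) ->
  forall L : set T', measurable L ->
  [set w | delta <= f (Zs (order_index Zs (Ordinal mn) w) w)] `<=` L ->
  prQ (first_in Zs Xs B m) <= c ^+ m + (n ^ 2)%:R / N%:R + prQ L.
Proof.
move=> c0 Hc L mL sL; have Np : 0 < N%:R :> R by rewrite ltr0n.
pose early v := valid v && (v.2%:R / N%:R < delta).
have mU C : measurable C -> measurable [set w | exists2 v, early v & box C v w].
  by move=> mC; apply: measurable_exists => v _; exact: mbox.
apply: le_trans (_ : _ <= prQ ([set w | exists2 v, early v & box B v w] `|` tie `|` L)) _.
  apply: le_prob; first exact: measurable_first_in.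
    by apply: measurableU => //; apply: measurableU => //; exact: mU.
  move=> w Fw; have [Lw|NLw] := pselect (L w); [by right | left].
  have [t|nt] := pselect (tie w); [by right | left].
  have [v /andP[vv /eqP qv] bv] := box_cover mn nt.
  exists v; last by apply/box_first.
  rewrite /early vv /= ltNge; apply/negP => dv; apply: NLw; apply: sL => /=.
  apply: le_trans dv _; rewrite ler_pdivrMr// mulrC qv.
  by rewrite truncn_le.
apply: (le_trans (probU_le _ _ _)) => //; first by apply: measurableU => //; exact: mU.
rewrite lerD2r; apply: (le_trans (probU_le _ _ _)) => //; first exact: mU.
apply: lerD; last exact: prob_tie.
apply: (@le_trans _ _ (\sum_(v | early v) prQ (box B v))).
  by apply: prob_bigcup_le => v _; exact: mbox.
apply: (@le_trans _ _ (\sum_(v | early v) c ^+ m * prQ (box setT v))).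
  by apply: ler_sum => v /andP[vv dv]; apply: prob_box_le => //; exact: Hc.
rewrite -mulr_sumr -[leRHS]mulr1 ler_wpM2l ?exprn_ge0// -prob_bigcup; first last.
  by move=> u v w /andP[vu _] /andP[vv _]; exact: box_inj.
  by move=> v _; exact: mbox.
by apply: prob_le1; exact: mU.
Qed.

End Grid.

Let archi_div (K e : R) : 0 < e -> exists2 N, (0 < N)%N & K / N%:R <= e.
Proof.
move=> e0; exists (Num.trunc (K / e)).+1 => //.
rewrite ler_pdivrMr ?ltr0n// mulrC -ler_pdivrMr// ltW//.
exact: truncnS_gt.
Qed.

Lemma first_in_ge m c : (m < n)%N -> 0 <= c ->
  (forall t, c * prP [set w | f (Z w) < t] <= prP [set w | f (Z w) < t /\ B (X w)]) ->
  c ^+ m <= prQ (first_in Zs Xs B m).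
Proof.
move=> mn c0 Hc; apply/ler_addgt0Pr => e e0.
have [N N0 le_e] := archi_div (c ^+ m * (n ^ 2)%:R) e0.
have := grid_lower N0 mn c0 Hc; rewrite mulrBr mulr1 lerBlDr => /le_trans; apply.
by rewrite lerD2l mulrA.
Qed.

(** For [m < n] these are consecutive runs of [n %/ m.+1] indices, the remainder lying in no block.
    Their growing length yields a geometric bound without a binomial tail estimate. *)
Definition block m (i : 'I_m.+1) : {set 'I_n} :=
  [set j : 'I_n | (j %/ (n %/ m.+1))%N == i]%SET.

Let card_block m (i : 'I_m.+1) : (n %/ m.+1 <= #|block i|)%N.
Proof.
set h := (n %/ m.+1)%N.
have ltn_g (x : 'I_h) : (i * h + x < n)%N.
  rewrite (@leq_trans (i.+1 * h))//; first by rewrite mulSn addnC ltn_add2r.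
  by apply: leq_trans (leq_divM n m.+1); rewrite mulnC leq_mul2l ltn_ord orbT.
pose g x := Ordinal (ltn_g x).
have g_inj : injective g by move=> x y /(congr1 val) /= /addnI /ord_inj.
rewrite -[X in (X <= _)%N]card_ord -(card_imset _ g_inj) subset_leq_card//.
apply/fintype.subsetP => _ /imsetP[x _ ->]; rewrite inE /= -/h.
have h0 : (0 < h)%N by exact: leq_ltn_trans (ltn_ord x).
by rewrite divnMDl// divn_small ?ltn_ord// addn0.
Qed.

(* If the [m+1]-st smallest value is at least [delta], only [m] indices can
   carry values below [delta], so one of [m+1] disjoint blocks avoids them. *)
Lemma late_block m (mn : (m < n)%N) delta w :
  delta <= f (Zs (order_index Zs (Ordinal mn) w) w) ->
  exists i : 'I_m.+1, forall j, j \in block i -> delta <= f (Zs j w).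
Proof.
move=> le_delta.
pose J := [set order_index Zs i w | i in [set i : 'I_n | (i < m)%N]]%SET.
(* Pigeonhole: the [m] indices of [J] cannot hit all [m.+1] labels. Indices in no block are sent to
   label 0 by [inord]; this is harmless, as only the size of the image is counted. *)
have [i iNJ] : exists i : 'I_m.+1,
    i \notin [set inord (j %/ (n %/ m.+1)) | j : 'I_n in J]%SET.
  apply/existsP; apply: contraT; rewrite negb_exists => /forallP all_in.
  have /eqP : [set inord (j %/ (n %/ m.+1)) | j : 'I_n in J]%SET = [set: 'I_m.+1]%SET.
    by apply/setP => i; rewrite finset.in_setT; have := all_in i; rewrite negbK.
  rewrite eqEcard => /andP[_]; rewrite cardsT card_ord => lt_card.
  have := leq_trans lt_card (leq_imset_card _ _).
  rewrite card_imset ?card_ord_lt ?ltnn//; first exact: ltnW.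
  exact: order_index_inj.
exists i => j; rewrite inE => /eqP ji.
have [k kj] := order_index_surj Zs w j.
rewrite -kj; apply: le_trans le_delta _; apply/f_nd/order_index_le => /=.
rewrite leqNgt; apply/negP => km; move/negP: iNJ; apply.
apply/imsetP; exists j; last by rewrite ji inord_val.
by rewrite -kj imset_f// inE.
Qed.

(** The last term is the union bound over the blocks: one of them has all its values at least
    [delta], and its members are independent. A block larger than [n %/ m.+1] only lowers the
    power. *)
Lemma first_in_le m c delta : (m < n)%N -> 0 <= c ->
  (forall t, t < delta ->
    prP [set w | f (Z w) < t /\ B (X w)] <= c * prP [set w | f (Z w) < t]) ->
  prQ (first_in Zs Xs B m) <=
    c ^+ m + m.+1%:R * prP [set w | delta <= f (Z w)] ^+ (n %/ m.+1).
Proof.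
move=> mn c0 Hc; pose A := [set u : R * R | delta <= f u.1].
have mA : measurable A.
  rewrite (_ : A = fst @^-1` (f @^-1` `[delta, +oo[%classic)); last first.
    by apply/seteqP; split => u /=; rewrite in_itv /= andbT.
  rewrite -[X in measurable X]setTI; apply: measurable_fst => //.
  by rewrite -[X in measurable X]setTI; exact: mf.
pose F (i : 'I_m.+1) := [set w | forall j, j \in block i -> A (Zs j w, Xs j w)].
have mF i : measurable (F i) by exact: (@measurable_copies (block i) (fun=> A)).
have mL : measurable [set w | exists2 i, true & F i w].
  by apply: measurable_exists => i _; exact: mF.
set rho := prP _.
have rho01 : 0 <= rho <= 1.
  rewrite prob_ge0 prob_le1//.
  exact: (@measurable_pair_rv _ _ _ _ Z X A).
have le_L : prQ [set w | exists2 i, true & F i w] <= m.+1%:R * rho ^+ (n %/ m.+1).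
  apply: (@le_trans _ _ (\sum_(i : 'I_m.+1) prQ (F i))).
    by apply: prob_bigcup_le => i _; exact: mF.
  apply: (@le_trans _ _ (\sum_(i : 'I_m.+1) rho ^+ (n %/ m.+1))); last first.
    by rewrite sumr_const card_ord mulr_natl.
  apply: ler_sum => i _; rewrite /F (@prob_copies (block i) (fun=> A))// prodr_const.
  by case/andP: rho01 => r0 r1; apply: ler_wiXn2l => //; exact: card_block.
apply/ler_addgt0Pr => e e0.
have [N N0 le_e] := archi_div (n ^ 2)%:R e0.
apply: (le_trans (grid_upper (mn := mn) N0 c0 Hc mL _)).
  by move=> w /late_block[i Hi]; exists i.
by rewrite addrAC lerD// lerD2l.
Qed.

End Boxes.

(** * Uniformity of F_Y(Y) for a continuous cdf *)

Section CdfTransform.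
Context (R : realType) d (T : measurableType d) (P : probability T R)
  (Y : {RV P >-> R}).
Local Notation pr := (prob P).

Definition cdfr (y : R) : R := fine (cdf Y y).

Lemma cdfrE y : cdfr y = pr [set w | Y w <= y].
Proof. by []. Qed.

Lemma measurable_rv (A : set R) : measurable A -> measurable [set w | A (Y w)].
Proof. by move=> mA; rewrite -[X in measurable X]setTI; exact: measurable_funP. Qed.

Lemma cdfr_nd : {homo cdfr : x y / x <= y}.
Proof. by move=> x y xy; rewrite /cdfr fine_le ?fin_num_measure// cdf_nondecreasing. Qed.

Lemma cdfr01 y : 0 <= cdfr y <= 1.
Proof.
by rewrite fine_ge0 ?cdf_ge0//= -lee_fin fineK ?cdf_le1// fin_num_measure.
Qed.

Lemma measurable_cdfr : measurable_fun setT cdfr.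
Proof. exact: (nondecreasing_measurable _ cdfr_nd). Qed.

Lemma measurable_cdf_lt t : measurable [set w | cdfr (Y w) < t].
Proof.
apply: (@measurable_rv [set y | cdfr y < t]).
rewrite [X in measurable X](_ : _ = cdfr @^-1` `]-oo, t[%classic); last first.
  by apply/seteqP; split => y /=; rewrite in_itv.
by rewrite -[X in measurable X]setTI; exact: measurable_cdfr.
Qed.

Lemma measurable_cdf_le t : measurable [set w | cdfr (Y w) <= t].
Proof.
apply: (@measurable_rv [set y | cdfr y <= t]).
rewrite [X in measurable X](_ : _ = cdfr @^-1` `]-oo, t]%classic); last first.
  by apply/seteqP; split => y /=; rewrite in_itv.
by rewrite -[X in measurable X]setTI; exact: measurable_cdfr.
Qed.

Lemma measurable_rv_le y : measurable [set w | Y w <= y].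
Proof.
rewrite [X in measurable X](_ : _ = [set w | `]-oo, y]%classic (Y w)]); last first.
  by apply/seteqP; split => w /=; rewrite in_itv.
exact: measurable_rv.
Qed.

Hypothesis cdf_cont : continuous cdfr.

Lemma cdfr_onto t : 0 < t < 1 -> exists y, cdfr y = t.
Proof.
move=> /andP[t0 t1].
have [a ta] : exists a, cdfr a < t.
  have /fine_cvg /cvgr_lt /(_ _ t0) [M [_ HM]] := cvg_cdfNy0 Y.
  by exists (M - 1); apply: HM; rewrite ltrBlDr ltrDl.
have [b tb] : exists b, t < cdfr b.
  have /fine_cvg /cvgr_gt /(_ _ t1) [M [_ HM]] := cvg_cdfy1 Y.
  by exists (M + 1); apply: HM; rewrite ltrDl.
have ab : a <= b.
  by rewrite leNgt; apply/negP => /ltW /cdfr_nd; rewrite leNgt (lt_trans ta tb).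
have [|c _ <-] := @IVT R cdfr a b t ab (continuous_subspaceT cdf_cont).
  by rewrite ge_min le_max (ltW ta) (ltW tb) orbT.
by exists c.
Qed.

(** Probability integral transform without injectivity of F. If F(y) = s, then F(Y) < s forces Y <=
    y, an event of probability s; if F(y) = s - e, then Y <= y forces F(Y) < s. *)
Lemma prob_cdf_lt t : 0 <= t <= 1 -> pr [set w | cdfr (Y w) < t] = t.
Proof.
have ub s : 0 < s < 1 -> pr [set w | cdfr (Y w) < s] <= s.
  move=> s01; have [y ys] := cdfr_onto s01; rewrite -[leRHS]ys cdfrE.
  apply: le_prob; [exact: measurable_cdf_lt | exact: measurable_rv_le |].
  move=> w /= wy; rewrite leNgt; apply/negP => /ltW /cdfr_nd.
  by rewrite ys leNgt wy.
have lb s : s <= 1 -> s <= pr [set w | cdfr (Y w) < s].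
  move=> s1; apply/ler_addgt0Pl => e e0.
  have [se|se] := lerP (s - e) 0.
    by have := prob_ge0 P [set w | cdfr (Y w) < s]; lra.
  have [|y ys] := @cdfr_onto (s - e); first by rewrite se /= ltrBlDr (le_lt_trans s1)// ltrDl.
  rewrite addrC -lerBlDr -ys cdfrE; apply: le_prob; first exact: measurable_rv_le.
    exact: measurable_cdf_lt.
  by move=> w /= /cdfr_nd; rewrite ys => /le_lt_trans; apply; rewrite ltrBlDr ltrDl.
move=> /andP[]; rewrite le_eqVlt => /predU1P[<- _|t0].
  rewrite (_ : [set w | _] = set0) ?prob0//; apply/seteqP; split => w //=.
  by rewrite ltNge; have /andP[->] := cdfr01 (Y w).
rewrite le_eqVlt => /predU1P[->|t1]; apply/eqP; rewrite eq_le.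
  by rewrite lb// andbT prob_le1//; exact: measurable_cdf_lt.
by rewrite ub ?t0// lb// ltW.
Qed.

Lemma prob_cdf_le t : 0 <= t <= 1 -> pr [set w | cdfr (Y w) <= t] = t.
Proof.
move=> /andP[t0 t1]; apply/eqP; rewrite eq_le; apply/andP; split.
  apply/ler_addgt0Pr => e e0; have [et|te] := lerP 1 (t + e).
    by apply: le_trans et; apply: prob_le1; exact: measurable_cdf_le.
  rewrite -[leRHS]prob_cdf_lt; last by rewrite (ltW te) addr_ge0// ltW.
  apply: le_prob; [exact: measurable_cdf_le | exact: measurable_cdf_lt |].
  by move=> w /= /le_lt_trans; apply; rewrite ltrDl.
rewrite -[leLHS]prob_cdf_lt ?t0//; apply: le_prob.
- exact: measurable_cdf_lt.
- exact: measurable_cdf_le.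
- by move=> w /= /ltW.
Qed.

Lemma prob_cdf_itv a b : a <= b -> pr [set w | a <= cdfr (Y w) < b] <= b - a.
Proof.
move=> ab.
have E : pr [set w | a <= cdfr (Y w) < b] =
    pr [set w | cdfr (Y w) < b] - pr [set w | cdfr (Y w) < a].
  have := probIC P (measurable_cdf_lt b) (measurable_cdf_lt a) => <-.
  rewrite (_ : [set w | cdfr (Y w) < b] `&` [set w | cdfr (Y w) < a] =
    [set w | cdfr (Y w) < a]); last first.
    by apply/seteqP; split => w /= => [[]//|wa]; split => //; exact: lt_le_trans wa ab.
  rewrite addrAC subrr add0r; congr prob; apply/seteqP; split => w /=.
    by move=> /andP[aw wb]; split => //; apply/negP; rewrite -leNgt.
  by move=> [-> /negP]; rewrite -leNgt => ->.
rewrite E.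
(* The endpoints may leave [0, 1]: the top grid cell, for example, is [1, 1 + 1/N). *)
have [b0|b0] := lerP 0 b; last first.
  rewrite (_ : [set w | cdfr (Y w) < b] = set0) ?prob0; last first.
    apply/seteqP; split => w //= /lt_trans /(_ b0).
    by rewrite ltNge; have /andP[->] := cdfr01 (Y w).
  by have := prob_ge0 P [set w | cdfr (Y w) < a]; lra.
have [a1|a1] := lerP a 1; last first.
  rewrite (_ : [set w | cdfr (Y w) < a] = setT) ?probT; last first.
    apply/seteqP; split => w //= _; apply: le_lt_trans a1.
    by have /andP[] := cdfr01 (Y w).
  rewrite (@le_trans _ _ 0) ?subr_ge0// subr_le0 prob_le1//; exact: measurable_cdf_lt.
apply: lerB.
  have [b1|b1] := lerP b 1; first by rewrite prob_cdf_lt ?b0.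
  by apply: le_trans (ltW b1); rewrite prob_le1//; exact: measurable_cdf_lt.
have [a0|a0] := lerP 0 a; first by rewrite prob_cdf_lt ?a0.
by rewrite (le_trans (ltW a0))// prob_ge0.
Qed.

End CdfTransform.

(* The marginal cdf is the uniform limit of the continuous functions
   [joint_cdf Z X (_, k)], since the error is at most [P (X > k)]. *)
Lemma cdfr_continuous d (T : measurableType d) (R : realType)
    (P : probability T R) (Z X : {RV P >-> R}) :
  continuous (joint_cdf Z X) -> continuous (cdfr Z).
Proof.
move=> cZX z0; apply/cvgrPdist_lt => e e0.
have e3 : 0 < e / 3 by rewrite divr_gt0.
have [k Xk] : exists k, 1 - e / 3 < cdfr X k.
  have /fine_cvg /cvgr_gt H := cvg_cdfy1 X.
  have [|M [_ HM]] := H (1 - e / 3); first by rewrite ltrBlDr ltrDl.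
  by exists (M + 1); apply: HM; rewrite ltrDl.
have mle z : measurable [set w | Z w <= z /\ X w <= k].
  by apply: measurableI; exact: measurable_rv_le.
have approx z : 0 <= cdfr Z z - joint_cdf Z X (z, k) < e / 3.
  rewrite cdfrE -(probIC P (measurable_rv_le Z z) (measurable_rv_le X k)).
  rewrite [joint_cdf Z X _](_ : _ = prob P ([set w | Z w <= z] `&` [set w | X w <= k]))//.
  rewrite addrAC subrr add0r prob_ge0 /=.
  apply: (@le_lt_trans _ _ (prob P (~` [set w | X w <= k]))).
    apply: le_prob; last exact: subIsetr.
      by apply: measurableI; [|apply: measurableC]; exact: measurable_rv_le.
    by apply: measurableC; exact: measurable_rv_le.
  by rewrite probC -?cdfrE ?ltrBlDr -?ltrBlDl//; exact: measurable_rv_le.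
have : joint_cdf Z X (z, k) @[z --> z0] --> joint_cdf Z X (z0, k).
  apply: (@cvg_comp _ _ _ (fun z => (z, k)) (joint_cdf Z X) _ _ _ _ (cZX (z0, k))).
  exact: (@cvg_pair R R R (nbhs z0) (nbhs z0) (nbhs k) _ _ _ id (cst k) cvg_id (cvg_cst _)).
move=> /cvgrPdist_lt /(_ _ e3); apply: filterS => z.
have /andP[] := approx z; have /andP[] := approx z0.
rewrite !ltr_norml; lra.
Qed.

Lemma joint_cdf_sym d (T : measurableType d) (R : realType)
    (P : probability T R) (Z X : {RV P >-> R}) :
  continuous (joint_cdf Z X) -> continuous (joint_cdf X Z).
Proof.
move=> cZX [x z].
have -> : joint_cdf X Z = joint_cdf Z X \o (fun u => (u.2, u.1)).
  apply/funext => u; rewrite /joint_cdf /=; congr (fine (P _)).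
  by apply/seteqP; split => w [].
apply: (@cvg_comp _ _ _ (fun u : R * R => (u.2, u.1)) (joint_cdf Z X) _ _ _ _ (cZX (z, x))).
exact: (@cvg_pair (R * R) R R (nbhs (x, z)) (nbhs z) (nbhs x) _ _ _ snd fst
  cvg_snd cvg_fst).
Qed.

(** * Bounds from conditional distributions, and the SIPD inequality *)

Section CondDistribution.
Context (R : realType) d (T : measurableType d) (P : probability T R).
Variables (V U : T -> R) (K : R.-pker R ~> R).
Hypothesis mV : measurable_fun setT V.
Hypothesis mU : measurable_fun setT U.
Hypothesis KP : is_cond_distribution P V U K.
Local Notation pr := (prob P).

Let mKV B (mB : measurable B) := measurableT_comp (measurable_kernel K B mB) mV.

Let mVA A : measurable A -> measurable (V @^-1` A).
Proof. by move=> mA; rewrite -[X in measurable X]setTI; exact: mV. Qed.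

Let mUB B : measurable B -> measurable (U @^-1` B).
Proof. by move=> mB; rewrite -[X in measurable X]setTI; exact: mU. Qed.

(** The kernel bound is asked almost everywhere because monotonicity is known only on the support of
    Z, or only on (0, 1) for the copula. *)
Lemma cond_prob_le A B c : measurable A -> measurable B -> 0 <= c ->
  {ae P, forall w, A (V w) -> (K (V w) B <= c%:E)%E} ->
  pr [set w | A (V w) /\ B (U w)] <= c * pr [set w | A (V w)].
Proof.
move=> mA mB c0 Hc; rewrite -lee_fin EFinM -!probE; last 2 first.
  exact: mVA.
  by apply: measurableI; [exact: mVA | exact: mUB].
rewrite (KP mA mB) -(integral_cst P (mVA mA)).
apply: ae_ge0_le_integral => //; first exact: mVA.
by apply: measurable_funTS; exact: mKV.
Qed.

Lemma cond_prob_ge A B c : measurable A -> measurable B -> 0 <= c ->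
  {ae P, forall w, A (V w) -> (c%:E <= K (V w) B)%E} ->
  c * pr [set w | A (V w)] <= pr [set w | A (V w) /\ B (U w)].
Proof.
move=> mA mB c0 Hc; rewrite -lee_fin EFinM -!probE; last 2 first.
  by apply: measurableI; [exact: mVA | exact: mUB].
  exact: mVA.
rewrite (KP mA mB) -(integral_cst P (mVA mA)).
apply: ae_ge0_le_integral => //; first exact: mVA.
by apply: measurable_funTS; exact: mKV.
Qed.

End CondDistribution.

(** A point off the support lies in an interval with rational endpoints that Z almost surely avoids,
    and there are countably many of these; [F] lists their preimages. *)
Lemma ae_rv_support d (T : measurableType d) (R : realType)
    (P : probability T R) (Z : {RV P >-> R}) :
  {ae P, forall w, rv_support Z (Z w)}.
Proof.
pose F k : set T := if unpickle k is Some (p, q) then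
  (if P (Z @^-1` `]ratr p, ratr q[%classic) == 0%E
   then Z @^-1` `]ratr p, ratr q[%classic else set0) else set0.
apply: (@negligibleS _ _ _ _ (\bigcup_k F k)); last first.
  apply: negligible_bigcup => k; rewrite /F; case: unpickle => [[p q]|]; last first.
    exact: negligible_set0.
  case: eqP => [H|_]; last exact: negligible_set0.
  by apply/negligibleP => //; rewrite -[X in measurable X]setTI; exact: measurable_funP.
move=> w /= /existsNP[A /not_implyP[oA /not_implyP[Aw /negP]]].
rewrite -leNgt measure_le0 => /eqP PA0.
have /nbhs_ballP[e /= e0 eA] := open_nbhs_nbhs (conj oA Aw).
have [|p] := @rat_in_itvoo R (Z w - e) (Z w); first by rewrite ltrBlDr ltrDl.
have [|q] := @rat_in_itvoo R (Z w) (Z w + e); first by rewrite ltrDl.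
rewrite !in_itv /= => /andP[wq qe] /andP[ep pw].
exists (pickle (p, q)); first exact: I.
rewrite /F pickleK.
case: eqP => [_|]; first by rewrite /= in_itv /= pw.
case; apply/eqP; rewrite -measure_le0 -PA0; apply: le_measure.
- by rewrite inE -[X in measurable X]setTI; exact: measurable_funP.
- rewrite inE -[X in measurable X]setTI; apply: measurable_funP => //.
  exact: open_measurable.
- move=> v /=; rewrite in_itv /= => /andP[pv vq]; apply: eA.
  by rewrite /ball /= ltr_norml; apply/andP; split; lra.
Qed.

(* The conditional tail probability is non-decreasing on the support, so its
   values over [L] lie below some [g], and its values outside lie above [g]. *)
Lemma sipd_lower_set d (T : measurableType d) (R : realType)
    (P : probability T R) (Z X : {RV P >-> R}) (L : set R) (x : R) :
  sipd Z X -> measurable L -> (forall y z, L z -> y <= z -> L y) ->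
  prob P [set w | L (Z w) /\ x < X w] <=
    prob P [set w | x < X w] * prob P [set w | L (Z w)].
Proof.
move=> [K KP Kmono] mL lowL; set B : set R := `]x, +oo[%classic.
have mB : measurable B by exact: measurable_itv.
have Bx w : B (X w) = (x < X w) by rewrite /B /= in_itv /= andbT.
pose k z := fine (K z B).
have kE z : K z B = (k z)%:E.
  rewrite /k fineK// ge0_fin_numE// (@le_lt_trans _ _ 1%E) ?ltry//.
  rewrite -(@prob_kernel _ _ _ _ _ K z); apply: le_measure => //; rewrite inE//.
have k01 z : 0 <= k z <= 1.
  rewrite -!lee_fin -!kE measure_ge0 /= -(@prob_kernel _ _ _ _ _ K z).
  by apply: le_measure => //; rewrite inE.
have kmono z z' : rv_support Z z -> rv_support Z z' -> z <= z' -> k z <= k z'.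
  by move=> Sz Sz' zz'; rewrite -lee_fin -!kE; exact: Kmono.
have mZL C : measurable C -> measurable [set w | C (Z w)] by exact: measurable_rv.
have mXB : measurable [set w | x < X w].
  by under eq_set do rewrite -Bx; exact: measurable_rv.
have mI C : measurable C -> measurable [set w | C (Z w) /\ x < X w].
  by move=> mC; apply: measurableI; [exact: mZL | exact: mXB].
set s := prob P [set w | L (Z w)].
have s01 : 0 <= s <= 1 by rewrite prob_ge0 prob_le1//; exact: mZL.
have sC : prob P [set w | (~` L) (Z w)] = 1 - s by rewrite -probC//; exact: mZL.
set a := prob P [set w | L (Z w) /\ x < X w].
pose b := prob P [set w | (~` L) (Z w) /\ x < X w].
have ab : prob P [set w | x < X w] = a + b.
  rewrite -(probIC P mXB (mZL _ mL)) /a /b.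
  by congr (_ + _); rewrite setIC.
have [g [g0 gL gR]] : exists g, [/\ 0 <= g,
    (forall z, rv_support Z z -> L z -> k z <= g) &
    (forall z, rv_support Z z -> ~ L z -> s * g <= s * k z)].
  have [[z1 [S1 L1]]|none] := pselect (exists z, rv_support Z z /\ L z); last first.
    exists 0; split => // [z Sz Lz|z Sz Lz]; first by case: none; exists z.
    by rewrite mulr0 mulr_ge0//; [case/andP: s01 | case/andP: (k01 z)].
  (* The separating level is the supremum over [L]: a support point outside the lower set [L]
     exceeds every point of [L], hence bounds all values in [E]. *)
  pose E := [set k z | z in [set z | rv_support Z z /\ L z]].
  have hE : has_sup E.
    split; first by exists (k z1); exists z1.
    by exists 1 => _ [z _ <-]; case/andP: (k01 z).
  exists (sup E); split => [|z Sz Lz|z Sz NLz].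
  - apply: le_trans (_ : k z1 <= _); first by case/andP: (k01 z1).
    by apply: ub_le_sup; [case: hE | exists z1].
  - by apply: ub_le_sup; [case: hE | exists z].
  - rewrite ler_wpM2l//; first by case/andP: s01.
    apply: ge_sup; first by case: hE.
    move=> _ [y [Sy Ly] <-]; apply: kmono => //.
    by rewrite leNgt; apply/negP => /ltW zy; apply: NLz; exact: lowL zy.
have aeS := ae_rv_support Z.
have le_a : a <= g * s.
  rewrite /a; under eq_set do rewrite -Bx.
  apply: (@cond_prob_le R d T P Z X K) => //.
  by apply: filterS aeS => w Sw Lw; rewrite kE lee_fin; exact: gL.
have le_b : s * (g * (1 - s)) <= s * b.
  have [->|s0] := eqVneq s 0; first by rewrite !mul0r.
  have sp : 0 < s by rewrite lt_neqAle eq_sym s0; case/andP: s01.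
  rewrite ler_pM2l// -sC /b; under [in leRHS]eq_set do rewrite -Bx.
  apply: (@cond_prob_ge R d T P Z X K) => //; first exact: measurableC.
  apply: filterS aeS => w Sw NLw; rewrite kE lee_fin.
  by rewrite -(ler_pM2l sp); exact: gR.
(* Chaining gives [a * (1 - s) <= g * s * (1 - s) <= s * b], which rearranges to
   [a <= (a + b) * s]. *)
rewrite ab; case/andP: s01 => s0 s1.
have : a * (1 - s) <= g * s * (1 - s) by rewrite ler_wpM2r// subr_ge0.
lra.
Qed.

(** * Elementary bounds and the link with [p_success] *)

Section Concomitants.
Context (R : realType) d (T : measurableType d) (P : probability T R)
  (Z X : {RV P >-> R}) d' (T' : measurableType d') (Q : probability T' R)
  (n : nat) (Zs Xs : 'I_n -> {RV Q >-> R}).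
Hypothesis iid : iid_copies Z X Zs Xs.
Implicit Types (B : set R) (m : nat).

Lemma all_first_in B m w : (forall j, B (Xs j w)) -> first_in Zs Xs B m w.
Proof. by move=> H i _; exact: H. Qed.

Lemma prob_all_in B : measurable B ->
  prob Q [set w | forall j, B (Xs j w)] = prob P [set w | B (X w)] ^+ n.
Proof.
move=> mB; rewrite -[in RHS](card_ord n) -prodr_const.
have := prob_copies iid [set: 'I_n]%SET (A := fun=> [set u | B u.2]).
rewrite (eq_bigl xpredT) => [<-|j]; last by rewrite finset.in_setT.
  congr prob; apply/seteqP; split => w /= H j; first by move=> _; exact: H.
  exact: (H j (finset.in_setT j)).
by move=> _; rewrite -[X in measurable X]setTI; exact: measurable_snd.
Qed.

(** For [m = n] the concomitants are a permutation of all the X-values. *)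
Lemma prob_first_in_all B : measurable B ->
  prob Q (first_in Zs Xs B n) = prob P [set w | B (X w)] ^+ n.
Proof.
move=> mB; rewrite -prob_all_in//; congr prob; apply/seteqP; split => w; last first.
  exact: all_first_in.
move=> H j; have [i <-] := order_index_surj Zs w j; exact: H.
Qed.

Lemma prob_exists_copy_le (A : set (R * R)) : measurable A ->
  prob Q [set w | exists2 j, true & A (Zs j w, Xs j w)] <=
  n%:R * prob P [set w | A (Z w, X w)].
Proof.
move=> mA.
apply: (@le_trans _ _ (\sum_(j < n) prob Q [set w | A (Zs j w, Xs j w)])).
  by apply: prob_bigcup_le => j _; exact: measurable_pair_rv.
rewrite (eq_bigr (fun=> prob P [set w | A (Z w, X w)])); last first.
  by move=> j _; exact: (prob_copy iid).
by rewrite sumr_const card_ord mulr_natl.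
Qed.

(** A success requires some X_j outside [B]; with the failure set this gives the bound [n * alpha]
    used as alpha tends to 0. *)
Lemma probC_first_in_le B m : measurable B ->
  1 - prob Q (first_in Zs Xs B m) <= n%:R * (1 - prob P [set w | B (X w)]).
Proof.
move=> mB; rewrite -!probC; last 2 first.
  exact: measurable_rv.
  exact: measurable_first_in.
have mCB : measurable [set u : R * R | (~` B) u.2].
  by rewrite -[X in measurable X]setTI; apply: measurable_snd => //; exact: measurableC.
apply: le_trans (prob_exists_copy_le mCB); apply: le_prob.
- by apply: measurableC; exact: measurable_first_in.
- by apply: measurable_exists => j _; exact: measurable_pair_rv.
- move=> w /= /existsNP[i /not_implyP[_ NB]].
  by exists (order_index Zs i w).
Qed.

(** Used at alpha = 1, where the failure set is null; [0 < m] supplies a concomitant that must lie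
    in it. *)
Lemma prob_first_in_le_sum B m : (0 < m <= n)%N -> measurable B ->
  prob Q (first_in Zs Xs B m) <= n%:R * prob P [set w | B (X w)].
Proof.
move=> /andP[m0 mn] mB.
have mB2 : measurable [set u : R * R | B u.2].
  by rewrite -[X in measurable X]setTI; exact: measurable_snd.
apply: le_trans (prob_exists_copy_le mB2); apply: le_prob.
- exact: measurable_first_in.
- by apply: measurable_exists => j _; exact: measurable_pair_rv.
- move=> w H; pose i0 := Ordinal (leq_trans m0 mn).
  by exists (order_index Zs i0 w) => //; exact: (H i0).
Qed.

Lemma measurable_gt (xs : \bar R) : measurable [set x : R | (xs < x%:E)%E].
Proof.
case: xs => [r||].
- rewrite [X in measurable X](_ : _ = `]r, +oo[%classic)//.
  by apply/seteqP; split => x /=; rewrite in_itv /= andbT lte_fin.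
- rewrite [X in measurable X](_ : _ = set0)//.
  by apply/seteqP; split => x.
- rewrite [X in measurable X](_ : _ = setT)//.
  by apply/seteqP; split => x //= _; rewrite ltNyr.
Qed.

Lemma p_successE m (xs : \bar R) : (0 < m <= n)%N ->
  p_success Zs Xs m xs = 1 - prob Q (first_in Zs Xs [set x | (xs < x%:E)%E] m).
Proof.
move=> /andP[m0 mn]; rewrite -probC; last first.
  by apply: measurable_first_in; exact: measurable_gt.
congr (fine (Q _)); apply/seteqP; split => w /=.
  (* The minimum can also be at most [xs] through its default [+oo]; then [xs] is [+oo], and the
     first concomitant, present since [0 < m], is already a success. *)
  move=> /bigmin_leP[/=|[i im le_i] H]; last first.
    by have /= := H i im; rewrite ltNge le_i.
  rewrite leye_eq => /eqP -> H; pose i0 := Ordinal (leq_trans m0 mn).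
  by have /= := H i0 m0; rewrite ltNge leey.
move=> /existsNP[i /not_implyP[im /negP]]; rewrite -leNgt => le_i.
by apply/bigmin_leP; right; exists i.
Qed.

End Concomitants.

(** * The grid bounds for f = F_Z *)

Section CdfGrid.
Context (R : realType) d (T : measurableType d) (P : probability T R)
  (Z X : {RV P >-> R}) d' (T' : measurableType d') (Q : probability T' R)
  (n : nat) (Zs Xs : 'I_n -> {RV Q >-> R}).
Hypothesis iid : iid_copies Z X Zs Xs.
Hypothesis cZ : continuous (cdfr Z).
Variable B : set R.
Hypothesis mB : measurable B.

Lemma cdf_first_in_ge m c : (m < n)%N -> 0 <= c ->
  (forall t, c * prob P [set w | cdfr Z (Z w) < t] <=
    prob P [set w | cdfr Z (Z w) < t /\ B (X w)]) ->
  c ^+ m <= prob Q (first_in Zs Xs B m).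
Proof.
exact: (first_in_ge iid mB (@cdfr_nd _ _ _ _ Z) (cdfr01 Z) (prob_cdf_itv cZ)).
Qed.

Lemma cdf_first_in_le m c delta : (m < n)%N -> 0 <= c ->
  (forall t, t < delta -> prob P [set w | cdfr Z (Z w) < t /\ B (X w)] <=
    c * prob P [set w | cdfr Z (Z w) < t]) ->
  prob Q (first_in Zs Xs B m) <=
    c ^+ m + m.+1%:R * prob P [set w | delta <= cdfr Z (Z w)] ^+ (n %/ m.+1).
Proof.
exact: (first_in_le iid mB (@cdfr_nd _ _ _ _ Z) (cdfr01 Z) (prob_cdf_itv cZ)).
Qed.

Lemma first_in_le_exp m : (m <= n)%N ->
  (forall t, prob P [set w | cdfr Z (Z w) < t /\ B (X w)] <=
    prob P [set w | B (X w)] * prob P [set w | cdfr Z (Z w) < t]) ->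
  prob Q (first_in Zs Xs B m) <= prob P [set w | B (X w)] ^+ m.
Proof.
rewrite leq_eqVlt => /predU1P[-> _|mn H]; first by rewrite (prob_first_in_all iid).
(* The choice [delta = 2] exceeds every cdf value, so the late event is empty; its power vanishes
   because [m < n] makes the exponent positive. *)
have := cdf_first_in_le mn (prob_ge0 _ _) (fun t (_ : t < 2) => H t).
rewrite [X in prob P X ^+ (n %/ _)](_ : _ = set0); last first.
  apply/seteqP; split => w //=; have /andP[_] := cdfr01 Z (Z w); lra.
rewrite prob0 expr0n (_ : (_ == 0)%N = false) ?mulr0 ?addr0//.
by apply/negbTE; rewrite -lt0n divn_gt0.
Qed.

Lemma first_in_ge_exp m : (m <= n)%N ->
  (forall t, prob P [set w | B (X w)] * prob P [set w | cdfr Z (Z w) < t] <=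
    prob P [set w | cdfr Z (Z w) < t /\ B (X w)]) ->
  prob P [set w | B (X w)] ^+ m <= prob Q (first_in Zs Xs B m).
Proof.
rewrite leq_eqVlt => /predU1P[-> _|mn H]; first by rewrite (prob_first_in_all iid).
by apply: cdf_first_in_ge => //; exact: prob_ge0.
Qed.

End CdfGrid.

(** * Failure in terms of X and of F_X(X) *)

Section Quantile.
Context (R : realType) d (T : measurableType d) (P : probability T R)
  (X : {RV P >-> R}).
Hypothesis cX : continuous (cdfr X).
Variables (xs : \bar R) (alpha : R).
Hypothesis alpha01 : 0 < alpha <= 1.
Hypothesis xsP : P [set w | ((X w)%:E <= xs)%E] = alpha%:E.
Local Notation B := [set x : R | (xs < x%:E)%E].

Lemma prob_above : prob P [set w | B (X w)] = 1 - alpha.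
Proof.
have mB := measurable_rv X (measurable_gt xs).
rewrite -[LHS]opprK -[- prob _ _](addKr 1) opprD opprK addrC.
rewrite [in LHS]addrC -probC//; congr (1 - _).
rewrite /prob (_ : ~` _ = [set w | ((X w)%:E <= xs)%E]) ?xsP//.
by apply/seteqP; split => w /=; rewrite ltNge; [move/negP; rewrite negbK|move=> ->].
Qed.

Lemma cdf_below x : ~ B x -> cdfr X x <= alpha.
Proof.
move=> /= /negP; rewrite -leNgt; move: xsP; case: xs => [r||] //=.
- rewrite lee_fin => xr_ xr; have := cdfr_nd X xr; rewrite [cdfr X r]cdfrE.
  rewrite /prob (_ : [set w | X w <= r] = [set w | ((X w)%:E <= r%:E)%E]) ?xr_//.
- rewrite (_ : [set w | _] = setT) ?probability_setT => [[<-] _|].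
    by have /andP[] := cdfr01 X x.
  by apply/seteqP; split => w //= _; rewrite leey.
Qed.

(** F_X may be flat to the right of [xs]. Yet [X <= xs] implies [cdfr X X <= alpha] and both have
    probability alpha, so their difference is null. *)
Lemma prob_quantile_gap : prob P [set w | cdfr X (X w) <= alpha /\ B (X w)] = 0.
Proof.
have mB := measurable_rv X (measurable_gt xs).
have mle := measurable_cdf_le X alpha.
have := probIC P mle mB; rewrite (prob_cdf_le cX); last first.
  by case/andP: alpha01 => /ltW -> ->.
rewrite (_ : _ `&` ~` _ = ~` [set w | B (X w)]); last first.
  by apply/seteqP; split => w => [[]//|/= NB]; split => //; exact: cdf_below.
rewrite probC// prob_above => e.
rewrite (_ : [set w | _ /\ _] = [set w | cdfr X (X w) <= alpha] `&` [set w | B (X w)])//.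
lra.
Qed.

Lemma prob_above_cdf A : measurable A ->
  prob P (A `&` [set w | B (X w)]) = prob P (A `&` [set w | alpha < cdfr X (X w)]).
Proof.
move=> mA; have mB := measurable_rv X (measurable_gt xs).
have mle := measurable_cdf_le X alpha.
have mgt : measurable [set w | alpha < cdfr X (X w)].
  rewrite [X in measurable X](_ : _ = ~` [set w | cdfr X (X w) <= alpha]); first exact: measurableC.
  by apply/seteqP; split => w /=; rewrite ltNge => /negP.
apply/eqP; rewrite eq_le; apply/andP; split; last first.
  apply: le_prob; [exact: measurableI | exact: measurableI |].
  move=> w [Aw /= gt_w]; split => //=; apply: contrapT => /cdf_below.
  by rewrite leNgt gt_w.
have mgap : measurable [set w | cdfr X (X w) <= alpha /\ B (X w)] by exact: measurableI.
rewrite -[leRHS]addr0 -prob_quantile_gap.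
apply: le_trans (probU_le _ _ _) => //; last exact: measurableI.
apply: le_prob; [exact: measurableI | |].
  by apply: measurableU => //; exact: measurableI.
move=> w [Aw Bw]; have [le_w|gt_w] := lerP (cdfr X (X w)) alpha; last by left.
by right.
Qed.

End Quantile.

(** Outside a null event a pair fails exactly when F_Z(Z) > alpha. Failure of the first concomitant
    then puts the smallest Z above that level, hence all of them, and every X_j fails. *)
Lemma comonotonic_first_in (R : realType) d (T : measurableType d)
    (P : probability T R) (Z X : {RV P >-> R}) d' (T' : measurableType d')
    (Q : probability T' R) n (Zs Xs : 'I_n -> {RV Q >-> R}) m (xs : \bar R) alpha :
  iid_copies Z X Zs Xs -> continuous (cdfr X) -> comonotonic Z X ->
  0 < alpha <= 1 -> P [set w | ((X w)%:E <= xs)%E] = alpha%:E -> (0 < m <= n)%N ->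
  prob Q (first_in Zs Xs [set x | (xs < x%:E)%E] m) = (1 - alpha) ^+ n.
Proof.
move=> iid cX ZX a01 xsP /andP[m0 mn]; set B := [set x : R | (xs < x%:E)%E].
have mB : measurable B by exact: measurable_gt.
have ZXr w : cdfr Z (Z w) = cdfr X (X w) by rewrite /cdfr ZX.
have mall : measurable [set w | forall j, B (Xs j w)].
  rewrite [X in measurable X](_ : _ = [set w | forall j, true -> B (Xs j w)]).
    by apply: measurable_forall => j _; exact: measurable_rv.
  by apply/seteqP; split => w /= H j; [by move=> _|]; exact: H.
have mF := measurable_first_in Zs Xs m mB.
rewrite -(prob_above xsP) -/B -(prob_all_in iid)//.
apply/eqP; rewrite eq_le; apply/andP; split; last first.
  by apply: le_prob => // w /= H; exact: all_first_in.
(* The pairs for which the level test on Z and failure of X disagree. As a condition on one pair,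
   its nullity passes to the copies through their common law. *)
pose A := [set u : R * R | (cdfr Z u.1 <= alpha /\ B u.2) \/
                           (~ (cdfr Z u.1 <= alpha) /\ ~ B u.2)].
have mle : measurable [set u : R * R | cdfr Z u.1 <= alpha].
  rewrite [X in measurable X](_ : _ = fst @^-1` (cdfr Z @^-1` `]-oo, alpha]%classic)); last first.
    by apply/seteqP; split => u /=; rewrite in_itv.
  rewrite -[X in measurable X]setTI; apply: measurable_fst => //.
  by rewrite -[X in measurable X]setTI; exact: measurable_cdfr.
have mB2 : measurable [set u : R * R | B u.2].
  by rewrite -[X in measurable X]setTI; exact: measurable_snd.
have mA : measurable A.
  apply: measurableU; first exact: measurableI.
  by apply: measurableI; exact: measurableC.
have PA : prob P [set w | A (Z w, X w)] = 0.
  rewrite -(prob_quantile_gap cX a01 xsP); congr prob.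
  apply/seteqP; split => w /=; rewrite /A /= ZXr; last by left.
  by move=> [//|[le_w NB]]; case: le_w; exact: (cdf_below xsP).
have := prob_exists_copy_le iid mA; rewrite PA mulr0 => A0.
have mA' : measurable [set w | exists2 j, true & A (Zs j w, Xs j w)].
  by apply: measurable_exists => j _; exact: measurable_pair_rv.
apply: (@le_trans _ _ (prob Q ([set w | forall j, B (Xs j w)] `|`
    [set w | exists2 j, true & A (Zs j w, Xs j w)]))).
  apply: le_prob => //; first exact: measurableU.
  move=> w Fw; have [Aw|NA] := pselect (exists2 j, true & A (Zs j w, Xs j w)); [by right|left].
  move=> j; apply: contrapT => NBj.
  pose i0 := Ordinal (leq_trans m0 mn); have := Fw i0 m0; rewrite /concomitant.
  have [i ij] := order_index_surj Zs w j.
  have le0 := order_index_le Zs w (leq0n i : (i0 <= i)%N).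
  move=> B0; apply: (NA); exists (order_index Zs i0 w) => //; left; split => //=.
  apply: le_trans (cdfr_nd Z le0) _; rewrite ij; apply: contrapT => gt_j.
  by apply: NA; exists j => //; right.
by apply: (le_trans (probU_le _ _ _)) => //; rewrite -[leRHS]addr0 lerD2l.
Qed.

Lemma cvg_divn (m : nat) : (fun n => n %/ m.+1)%N @ \oo --> \oo.
Proof.
apply/cvgnyPge => A; exists (A * m.+1)%N => // n /= An.
by rewrite leq_divRL.
Qed.

(** * The limit for fixed m through the conditional copula *)

Section CopulaLimit.
Context (R : realType) d (T : measurableType d) (P : probability T R)
  (Z X : {RV P >-> R}).
Hypothesis cZ : continuous (cdfr Z).
Hypothesis cX : continuous (cdfr X).
Variables (K : R.-pker R ~> R) (alpha : R) (xs : \bar R).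
Hypothesis KP : is_cond_copula_kernel Z X K.
Hypothesis alpha01 : 0 < alpha <= 1.
Hypothesis xsP : P [set w | ((X w)%:E <= xs)%E] = alpha%:E.
Local Notation pr := (prob P).
Local Notation u := (cond_copula K alpha).
Local Notation C0 := (cond_copula0 K alpha).
Local Notation B := [set x : R | (xs < x%:E)%E].

Let K_fin z (A : set R) : measurable A -> K z A \is a fin_num.
Proof.
move=> mA; rewrite ge0_fin_numE// (@le_lt_trans _ _ 1%E) ?ltry//.
by rewrite -(@prob_kernel _ _ _ _ _ K z); apply: le_measure => //; rewrite inE.
Qed.

Let uE z : K z `]-oo, alpha]%classic = (u z)%:E.
Proof. by rewrite /cond_copula fineK// K_fin. Qed.

Let u01 z : 0 <= u z <= 1.
Proof.
rewrite -!lee_fin -!uE measure_ge0 /= -(@prob_kernel _ _ _ _ _ K z).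
by apply: le_measure => //; rewrite inE.
Qed.

Let KCE z : K z `]alpha, +oo[%classic = (1 - u z)%:E.
Proof.
have : (K z setT = K z `]-oo, alpha]%classic + K z `]alpha, +oo[%classic)%E.
  rewrite -measureU//.
    congr (K z _); apply/seteqP; split => x //= _; rewrite !in_itv /= andbT.
    by case: lerP => _; [left|right].
  apply/seteqP; split => x //= []; rewrite !in_itv /= andbT leNgt.
  by move=> /negP.
rewrite prob_kernel uE -(fineK (K_fin z _)) => [[->]|]; last exact: measurable_itv.
by rewrite addrAC subrr add0r.
Qed.

(** By monotonicity the right limit at 0 is the supremum of these values. *)
Let E := [set u z | z in `]0, 1[%classic].

Let E_sup : has_sup E.
Proof.
split; first by exists (u 2^-1), 2^-1 => //=; rewrite in_itv /= invr_gt0 ltr0n invf_lt1// ltr1n.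
by exists 1 => _ [z _ <-]; case/andP: (u01 z).
Qed.

Let C0E : C0 = sup E.
Proof.
apply/cvg_lim => //.
apply: (@nonincreasing_at_right_cvgr _ _ 0 (BLeft 1)); last by case: E_sup.
  by rewrite bnd_simp.
move=> x y; rewrite !in_itv /= => /andP[x0 x1] /andP[y0 y1] yx.
by rewrite -lee_fin -!uE; exact: KP.2.
Qed.

Let u_le z : 0 < z < 1 -> u z <= C0.
Proof. by move=> z01; rewrite C0E; apply: ub_le_sup; [case: E_sup | exists z; rewrite //= in_itv]. Qed.

Let C01 : 0 <= C0 <= 1.
Proof.
have h : 0 < (2^-1 : R) < 1 by rewrite invr_gt0 ltr0n invf_lt1// ltr1n.
apply/andP; split; first by apply: le_trans (u_le h); case/andP: (u01 2^-1).
by rewrite C0E; apply: ge_sup; [case: E_sup | move=> _ [z _ <-]; case/andP: (u01 z)].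
Qed.

Let ae01 : {ae P, forall w, 0 < cdfr Z (Z w) < 1}.
Proof.
apply: (@negligibleS _ _ _ _ ([set w | cdfr Z (Z w) <= 0] `|` ~` [set w | cdfr Z (Z w) < 1])).
  move=> w /= /negP; rewrite negb_and -!leNgt => /orP[->|]; [by left|].
  by rewrite leNgt => /negP; right.
have mlt := measurable_cdf_lt Z 1; have mle := measurable_cdf_le Z 0.
have mC : measurable (~` [set w | cdfr Z (Z w) < 1]) by exact: measurableC.
have P0 : P [set w | cdfr Z (Z w) <= 0] = 0%E.
  by rewrite (probE P mle) prob_cdf_le// lexx ler01.
have P1 : P (~` [set w | cdfr Z (Z w) < 1]) = 0%E.
  by rewrite (probE P mC) probC// prob_cdf_lt ?subrr// lexx ler01.
by apply: negligibleU; apply/negligibleP.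
Qed.

Let mV : measurable_fun setT (cdf_transform Z).
Proof. exact: measurableT_comp (measurable_cdfr Z) _. Qed.

Let mU : measurable_fun setT (cdf_transform X).
Proof. exact: measurableT_comp (measurable_cdfr X) _. Qed.

Let mlt t : measurable [set w | cdfr Z (Z w) < t] := measurable_cdf_lt Z t.

Let above_E t : pr [set w | cdfr Z (Z w) < t /\ B (X w)] =
  pr [set w | `]-oo, t[%classic (cdf_transform Z w) /\
              `]alpha, +oo[%classic (cdf_transform X w)].
Proof.
apply: (etrans (prob_above_cdf cX alpha01 xsP (mlt t))); congr prob.
by apply/seteqP; split => w /=; rewrite !in_itv /= andbT.
Qed.

Let below_E t : pr [set w | cdfr Z (Z w) < t] =
  pr [set w | `]-oo, t[%classic (cdf_transform Z w)].
Proof. by congr prob; apply/seteqP; split => w /=; rewrite in_itv. Qed.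

Lemma copula_tail_ge t : (1 - C0) * pr [set w | cdfr Z (Z w) < t] <=
  pr [set w | cdfr Z (Z w) < t /\ B (X w)].
Proof.
rewrite above_E below_E; apply: (cond_prob_ge mV mU KP.1) => //.
  by rewrite subr_ge0; case/andP: C01.
by apply: filterS ae01 => w w01 _; rewrite KCE lee_fin lerB// u_le.
Qed.

(** Take [delta] to be a point where [u] is within [eta] of its supremum; monotonicity keeps [u] at
    least as large at all smaller points of (0, 1). *)
Lemma copula_tail_le eta : 0 < eta -> exists2 delta, 0 < delta < 1 &
  forall t, t < delta -> pr [set w | cdfr Z (Z w) < t /\ B (X w)] <=
    (1 - C0 + eta) * pr [set w | cdfr Z (Z w) < t].
Proof.
move=> eta0; have [_ [z /= + <-]] := sup_adherent eta0 E_sup.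
rewrite in_itv /= -C0E => z01 uz; exists z => // t tz.
rewrite above_E below_E; apply: (cond_prob_le mV mU KP.1) => //.
  by case/andP: C01 => _ C1; rewrite addr_ge0 ?subr_ge0// ltW.
apply: filterS ae01 => w /andP[w0 w1] /=; rewrite in_itv /= => wt.
have uw : u z <= u (cdf_transform Z w).
  rewrite -lee_fin -!uE; apply: KP.2 => //; last by case/andP: z01.
  exact/ltW/(lt_trans wt).
by rewrite KCE lee_fin; move: uw uz; lra.
Qed.

(** The lower bound [(1 - C0) ^+ m] holds whenever [m < n]. Above, half of [e] pays for [eta], fixed
    first, and half for the late term, geometric with ratio [1 - delta]. *)
Lemma cvg_copula_first_in (ds : nat -> measure_display)
    (Ts : forall n, measurableType (ds n)) (Q : forall n, probability (Ts n) R)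
    (Zs Xs : forall n, 'I_n -> {RV (Q n) >-> R}) m :
  (forall n, iid_copies Z X (Zs n) (Xs n)) ->
  prob (Q n) (first_in (Zs n) (Xs n) B m) @[n --> \oo] --> (1 - C0) ^+ m.
Proof.
move=> iid; apply/cvgrPdist_le => e e0.
have e2 : 0 < e / 2 by rewrite divr_gt0.
have C1 : 0 <= 1 - C0 by rewrite subr_ge0; case/andP: C01.
have [eta eta0 le_eta] : exists2 eta, 0 < eta & (1 - C0 + eta) ^+ m <= (1 - C0) ^+ m + e / 2.
  have /cvgrPdist_le /(_ _ e2) /nbhs_ballP[r /= r0 Hr] := @exprn_continuous R m (1 - C0).
  exists (r / 2); first by rewrite divr_gt0.
  have /Hr : ball (1 - C0) r (1 - C0 + r / 2).
    by rewrite /ball /= opprD addNKr normrN gtr0_norm ?divr_gt0// ltr_pdivrMr// ltr_pMr// ltr1n.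
  by rewrite /= distrC ler_norml => /andP[_]; rewrite lerBlDl.
have [delta /andP[d0 d1] Hd] := copula_tail_le eta0.
have mB : measurable B by exact: measurable_gt.
have rho1 : pr [set w | delta <= cdfr Z (Z w)] = 1 - delta.
  rewrite -{2}(@prob_cdf_lt _ _ _ _ Z cZ delta) ?(ltW d0) ?(ltW d1)// -probC//.
  by congr prob; apply/seteqP; split => w /=; rewrite leNgt => /negP.
have : (m.+1%:R * (1 - delta) ^+ (n %/ m.+1)) @[n --> \oo] --> (m.+1%:R * 0 : R).
  apply: cvgMr; apply: (@cvg_comp _ _ _ (fun n => n %/ m.+1)%N (fun n => (1 - delta) ^+ n)).
    exact: cvg_divn.
  by apply: cvg_expr; rewrite ger0_norm ?subr_ge0 ?(ltW d1)// ltrBlDr ltrDl.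
rewrite mulr0 => /cvgrPdist_le /(_ _ e2) => Hlim.
near=> n.
have mn : (m < n)%N by near: n; exact: nbhs_infty_gt.
have lo := cdf_first_in_ge (iid n) cZ mB mn C1 copula_tail_ge.
have c0 : 0 <= 1 - C0 + eta by rewrite addr_ge0// ltW.
have := cdf_first_in_le (iid n) cZ mB mn c0 Hd; rewrite rho1 => up.
have : `|0 - m.+1%:R * (1 - delta) ^+ (n %/ m.+1)| <= e / 2 by near: n.
rewrite sub0r normrN ler_norml => /andP[_ sm].
rewrite distrC ler_norml; apply/andP; split; first by move: lo e0; lra.
by move: up sm le_eta; lra.
Unshelve. all: by end_near.
Qed.

End CopulaLimit.

Lemma sipd_above (R : realType) d (T : measurableType d) (P : probability T R)
    (Z X : {RV P >-> R}) (xs : \bar R) t : sipd Z X ->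
  prob P [set w | cdfr Z (Z w) < t /\ (xs < (X w)%:E)%E] <=
    prob P [set w | (xs < (X w)%:E)%E] * prob P [set w | cdfr Z (Z w) < t].
Proof.
move=> ZX; case: xs => [r||].
- under eq_set do rewrite lte_fin.
  under [in leRHS]eq_set do rewrite lte_fin.
  apply: (@sipd_lower_set _ _ _ _ _ _ [set z | cdfr Z z < t]) => //.
    rewrite [X in measurable X](_ : _ = cdfr Z @^-1` `]-oo, t[%classic); last first.
      by apply/seteqP; split => z /=; rewrite in_itv.
    by rewrite -[X in measurable X]setTI; exact: measurable_cdfr.
  by move=> y z /= zt /(cdfr_nd Z) /le_lt_trans; apply.
- rewrite (_ : [set w | _ /\ _] = set0) ?prob0 ?mulr_ge0 ?prob_ge0//.
  by apply/seteqP; split => w // [].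
- rewrite [X in _ <= prob P X * _](_ : _ = setT) ?probT ?mul1r; last first.
    by apply/seteqP; split => w //= _; rewrite ltNyr.
  rewrite [X in prob P X <= _](_ : _ = [set w | cdfr Z (Z w) < t])//.
  by apply/seteqP; split => w /= => [[]//|wt]; split => //; rewrite ltNyr.
Qed.

Theorem proposition3p4 (R : realType)
  (d : measure_display) (T : measurableType d) (P : probability T R)
  (Z X : {RV P >-> R})
  (joint_cont : continuous (joint_cdf Z X))
  (sipdZX : sipd Z X)
  (* for each sample size, i.i.d. copies of (Z, X) on some probability space *)
  (ds : nat -> measure_display) (Ts : forall n, measurableType (ds n))
  (Q : forall n, probability (Ts n) R)
  (Zs Xs : forall n, 'I_n -> {RV (Q n) >-> R})
  (iid : forall n, iid_copies Z X (Zs n) (Xs n))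
  (* x^*_alpha; the value +oo is possible for alpha = 1 *)
  (xstar : R -> \bar R)
  (xstarP : forall alpha : R, 0 < alpha <= 1 ->
     P [set w | ((X w)%:E <= xstar alpha)%E] = alpha%:E) :
  let p (n m : nat) (alpha : R) : R :=
    p_success (Zs n) (Xs n) m (xstar alpha) in
  (* (a) *)
  (forall (n : nat) (alpha : R), (0 < n)%N -> 0 < alpha <= 1 ->
     p n n alpha = 1 - (1 - alpha) ^+ n) /\
  (* (b) *)
  (forall n m : nat, (0 < m <= n)%N -> p n m 1 = 1) /\
  (* (c) *)
  (forall n m : nat, (0 < m <= n)%N ->
     p n m alpha @[alpha --> 0^'+] --> (0 : R)) /\
  (* (d) *)
  (comonotonic Z X -> forall (n m : nat) (alpha : R),
     (0 < m <= n)%N -> 0 < alpha <= 1 ->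
     p n m alpha = 1 - (1 - alpha) ^+ n) /\
  (* (e) *)
  (independent_rv Z X -> forall (n m : nat) (alpha : R),
     (0 < m <= n)%N -> 0 < alpha <= 1 ->
     p n m alpha = 1 - (1 - alpha) ^+ m) /\
  (* (f) *)
  (forall alpha : R, 0 < alpha <= 1 -> forall ms ns : nat -> nat,
     (forall k, (0 < ms k <= ns k)%N) ->
     ms @ \oo --> \oo -> ns @ \oo --> \oo ->
     p (ns k) (ms k) alpha @[k --> \oo] --> (1 : R)) /\
  (* (g) *)
  (forall (alpha : R) (m : nat), 0 < alpha <= 1 -> (0 < m)%N ->
     forall K : R.-pker R ~> R, is_cond_copula_kernel Z X K ->
     p n m alpha @[n --> \oo] --> 1 - (1 - cond_copula0 K alpha) ^+ m).
Proof.
move=> p.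
have cZ := cdfr_continuous joint_cont.
have cX := cdfr_continuous (joint_cdf_sym joint_cont).
pose B alpha := [set x : R | (xstar alpha < x%:E)%E].
have mB alpha : measurable (B alpha) by exact: measurable_gt.
have pE n m alpha : (0 < m <= n)%N ->
    p n m alpha = 1 - prob (Q n) (first_in (Zs n) (Xs n) (B alpha) m).
  exact: p_successE.
have PB alpha : 0 < alpha <= 1 -> prob P [set w | B alpha (X w)] = 1 - alpha.
  by move=> a01; exact: (prob_above (xstarP _ a01)).
have S_le1 n m alpha : prob (Q n) (first_in (Zs n) (Xs n) (B alpha) m) <= 1.
  by apply: prob_le1; exact: measurable_first_in.
split; [|split; [|split; [|split; [|split; [|split]]]]].
- move=> n alpha n0 a01; rewrite pE ?n0 ?leqnn//.
  by rewrite (prob_first_in_all (iid n))// PB.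
- move=> n m mn; rewrite pE//.
  have := prob_first_in_le_sum (iid n) mn (mB 1).
  rewrite PB ?ltr01 ?lexx// subrr mulr0 => le0.
  have ge0 := prob_ge0 (Q n) (first_in (Zs n) (Xs n) (B 1) m).
  by apply/eqP; rewrite eq_le; apply/andP; split; lra.
- move=> n m mn; apply: (@squeeze_cvgr _ _ _ _ (cst 0) (fun a => n%:R * a)).
  + near=> a; have a01 : 0 < a <= 1.
      by apply/andP; split; near: a; [exact: nbhs_right_gt | exact: nbhs_right_le].
    rewrite pE// subr_ge0 S_le1 /=.
    apply: le_trans (probC_first_in_le (iid n) m (mB a)) _.
    by rewrite PB// opprB addrCA subrr addr0.
  + exact: cvg_cst.
  + rewrite -[X in _ --> X](mulr0 n%:R); apply: cvg_at_right_filter.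
    by apply: cvgMr; exact: cvg_id.
- move=> ZX n m alpha mn a01; rewrite pE//; congr (1 - _).
  exact: (comonotonic_first_in (iid n) cX ZX a01 (xstarP _ a01)).
- move=> ZX n m alpha mn a01; rewrite pE//; congr (1 - _).
  have indep t : prob P [set w | cdfr Z (Z w) < t /\ B alpha (X w)] =
      prob P [set w | B alpha (X w)] * prob P [set w | cdfr Z (Z w) < t].
    apply: EFin_inj; rewrite EFinM -!probE; first last.
    + by apply: measurableI; [exact: measurable_cdf_lt | exact: measurable_rv].
    + exact: measurable_rv.
    + exact: measurable_cdf_lt.
    rewrite muleC -(ZX [set z | cdfr Z z < t])//.
    rewrite [X in measurable X](_ : _ = cdfr Z @^-1` `]-oo, t[%classic); last first.
      by apply/seteqP; split => z /=; rewrite in_itv.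
    by rewrite -[X in measurable X]setTI; exact: measurable_cdfr.
  case/andP: mn => _ mn; rewrite -(PB _ a01).
  apply/eqP; rewrite eq_le; apply/andP; split.
    by apply: (first_in_le_exp (iid n) cZ (mB alpha) mn) => t; rewrite indep.
  by apply: (first_in_ge_exp (iid n) cZ (mB alpha) mn) => t; rewrite indep.
- move=> alpha a01 ms ns mn ms_oo _.
  (* SIPD makes independence the worst case, whose success probability is the lower envelope
     here. *)
  apply: (@squeeze_cvgr _ _ _ _ (fun k => 1 - (1 - alpha) ^+ ms k) (cst 1)).
  + near=> k; rewrite pE// lerD2l lerN2 gerBl prob_ge0 andbT -(PB _ a01).
    case/andP: (mn k) => _ mnk.
    apply: (first_in_le_exp (iid (ns k)) cZ (mB alpha) mnk) => t.
    exact: sipd_above.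
  + rewrite -[X in _ --> X]subr0; apply: cvgB; first exact: cvg_cst.
    apply: (@cvg_comp _ _ _ ms (fun j => (1 - alpha) ^+ j)); first exact: ms_oo.
    by apply: cvg_expr; case/andP: a01 => a0 a1; rewrite ger0_norm ?subr_ge0// ltrBlDr ltrDl.
  + exact: cvg_cst.
- move=> alpha m a01 m0 K KP.
  (* The formula [pE] requires [m <= n], so the two sequences are compared only eventually. *)
  apply: (@cvg_trans _ ((fun n => 1 - prob (Q n) (first_in (Zs n) (Xs n) (B alpha) m)) @ \oo)).
    apply: near_eq_cvg; near=> n; rewrite pE// m0 /=; near: n; exact: nbhs_infty_ge.
  apply: cvgB; first exact: cvg_cst.
  exact: (cvg_copula_first_in cZ cX KP a01 (xstarP _ a01) iid).
Unshelve. all: by end_near.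
Qed.
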